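(* Let $(M,h)$ be a closed Riemannian spin manifold, let $(N,g)$ be a Riemannian manifold, let $X$ be a Killing vector field on $N$, and let $(\phi,\psi)$ be a smooth Dirac-harmonic map from $M$ to $N$. Then the current defined by $$J_\alpha:=2\langle d\phi(e_\alpha),X(\phi)\rangle_{\phi^\ast TN}-\langle\nabla_\psi X(\phi),e_\alpha\cdot\psi\rangle_{\Sigma M\otimes\phi^\ast TN}$$ is conserved, that is, $\nabla_{e_\alpha}J_\alpha=0$ (the divergence of $J$ on $M$ vanishes).
   Context: $\Sigma M$ is the spinor bundle of $(M,h)$ with hermitian scalar product $\langle\cdot,\cdot\rangle_{\Sigma M}$ (conjugate-linear in the first slot) and metric spin connection. Clifford multiplication is skew-symmetric, $\langle\psi,Y\cdot\eta\rangle=-\langle Y\cdot\psi,\eta\rangle$, and satisfies $Y\cdot Z\cdot\psi+Z\cdot Y\cdot\psi=-2h(Y,Z)\psi$. $(e_\alpha)$ is a local orthonormal frame of $TM$ and repeated indices are summed. For a map $\phi\colon M\to N$, a vector spinor is a section $\psi$ of $\Sigma M\otimes\phi^\ast TN$, locally $\psi=\psi^i\otimes\partial_{y^i}$ with $\partial_{y^i}$ a local basis of $TN$ along $\phi$. With $\tilde\nabla$ the induced connection on $\Sigma M\otimes\phi^\ast TN$, the twisted Dirac operator is $\not D=e_\alpha\cdot\tilde\nabla_{e_\alpha}$. Dirac-harmonic maps are the critical points $(\phi,\psi)$ of $E(\phi,\psi)=\int_M(|d\phi|^2+\langle\psi,\not D\psi\rangle)\,dM$, i.e. the solutions of $$\tau(\phi)=\tfrac12\langle\psi^i,e_\alpha\cdot\psi^j\rangle_{\Sigma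 M}\,R^N(\partial_{y^i},\partial_{y^j})d\phi(e_\alpha),\qquad \not D\psi=0,$$ where $\tau(\phi)$ is the tension field and $R^N(Y,Z)=[\nabla_Y,\nabla_Z]-\nabla_{[Y,Z]}$ is the curvature of $N$. A vector field $X$ on $N$ is Killing if $\mathcal{L}_Xg=0$, i.e. $\nabla_{\partial_{y^i}}X_j+\nabla_{\partial_{y^j}}X_i=0$. The notation in $J_\alpha$ means $$\langle\nabla_\psi X(\phi),e_\alpha\cdot\psi\rangle:=\langle\psi^i,e_\alpha\cdot\psi^j\rangle_{\Sigma M}\,\nabla_{\partial_{y^i}}X_j,$$ with $X_j=g_{jk}X^k$ and $\nabla$ the Levi-Civita connection of $N$, evaluated along $\phi$. $J$ is viewed as a one-form (vector field) on $M$ with $J_\alpha=J(e_\alpha)$. *)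

(* Defs.v *)
From HB Require Import structures.
From mathcomp Require Export all_boot all_order all_algebra.
From mathcomp Require Export all_classical all_reals all_analysis.
From mathcomp Require Export complex.

Set Implicit Arguments.
Unset Strict Implicit.
Unset Printing Implicit Defensive.

Export Order.TTheory GRing.Theory Num.Theory.
Export numFieldNormedType.Exports.

Local Open Scope classical_set_scope.
Local Open Scope ring_scope.
Local Open Scope complex_scope.

(* Conventions: tangent vectors are row vectors of coordinates with respect to
   a chart, so a Jacobian (library [jacobian]) acts on the right.  The i-th
   coordinate vector field is [delta_mx 0 i], and ['D_Y f x] is the derivative
   of f at x along Y. *)

Section Smooth.
Context {R : realType} {m : nat}.
Implicit Types (U : set 'rV[R]_m).

Fixpoint C_ (k : nat) U (f : 'rV[R]_m -> R) : Prop :=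
  match k with
  | 0 => forall x, U x -> {for x, continuous f}
  | k'.+1 => (forall x, U x -> differentiable f x) /\
             (forall i : 'I_m, C_ k' U (fun x => 'D_(delta_mx 0 i) f x))
  end.

Definition smooth_on U (f : 'rV[R]_m -> R) : Prop := forall k, C_ k U f.

Definition csmooth_on U (f : 'rV[R]_m -> R[i]) : Prop :=
  smooth_on U (fun x => complex.Re (f x)) /\
  smooth_on U (fun x => complex.Im (f x)).

Definition cderive (Y : 'rV[R]_m) (f : 'rV[R]_m -> R[i]) (x : 'rV[R]_m)
    : R[i] :=
  'D_Y (fun z => complex.Re (f z)) x +i* 'D_Y (fun z => complex.Im (f z)) x.

End Smooth.

Section Manifolds.
Context {R : realType}.

(* [param a] is the inverse of [coord a]; only its values on
   [coord a @` dom a] are meaningful. *)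
Record manifold (m : nat) := Manifold {
  space :> topologicalType;
  chart : Type;
  dom : chart -> set space;
  coord : chart -> space -> 'rV[R]_m;
  param : chart -> 'rV[R]_m -> space;
  space_hausdorff : hausdorff_space space;
  space_second_countable : @second_countable space;
  dom_cover : forall p, exists a, dom a p;
  dom_open : forall a, open (dom a);
  coord_open : forall a, open (coord a @` dom a);
  coordK : forall a p, dom a p -> param a (coord a p) = p;
  coord_continuous : forall a, {within dom a, continuous (coord a)};
  param_continuous : forall a,
    {within coord a @` dom a, continuous (param a)};
  transition_smooth : forall a b (k : 'I_m),
    smooth_on (coord a @` (dom a `&` dom b))
      (fun x => coord b (param a x) 0 k) }.

Definition closed_manifold m (M : manifold m) : Prop := compact [set: M].

Definition transition m (M : manifold m) (a b : chart M) :
    'rV[R]_m -> 'rV[R]_m :=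
  fun x => coord b (param a x).

Definition smooth_map m n (M : manifold m) (N : manifold n) (phi : M -> N)
    : Prop :=
  continuous phi /\
  forall (a : chart M) (b : chart N) (k : 'I_n),
    smooth_on (coord a @` (dom a `&` phi @^-1` dom b))
      (fun x => coord b (phi (param a x)) 0 k).

Record vector_field n (N : manifold n) := VectorField {
  vf_comp :> chart N -> 'rV[R]_n -> 'rV[R]_n;
  vf_smooth : forall b (k : 'I_n),
    smooth_on (coord b @` dom b) (fun y => vf_comp b y 0 k);
  vf_transition : forall b c p, dom b p -> dom c p ->
    vf_comp c (coord c p) =
    vf_comp b (coord b p) *m jacobian (transition b c) (coord b p) }.

Record metric m (M : manifold m) := Metric {
  gram :> chart M -> 'rV[R]_m -> 'M[R]_m;
  gram_smooth : forall a (i j : 'I_m),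
    smooth_on (coord a @` dom a) (fun x => gram a x i j);
  gram_sym : forall a p, dom a p ->
    (gram a (coord a p))^T = gram a (coord a p);
  gram_pos : forall a p, dom a p -> forall v : 'rV[R]_m, v != 0 ->
    0 < (v *m gram a (coord a p) *m v^T) 0 0;
  gram_transition : forall a b p, dom a p -> dom b p ->
    let T := jacobian (transition a b) (coord a p) in
    gram a (coord a p) = T *m gram b (coord b p) *m T^T }.

End Manifolds.

Arguments manifold R m : clear implicits.

(* In this section g is the Gram matrix of a metric in one chart. *)
Section LeviCivita.
Context {R : realType} {n : nat}.
Variable g : 'rV[R]_n -> 'M[R]_n.

Definition inner (x Y Z : 'rV[R]_n) : R := (Y *m g x *m Z^T) 0 0.

(* The Christoffel symbol with lower indices i, j and upper index k. *)
Definition christoffel (x : 'rV[R]_n) (i j k : 'I_n) : R :=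
  2^-1 * \sum_(l < n) invmx (g x) k l *
    ('D_(delta_mx 0 i) (fun z => g z j l) x
     + 'D_(delta_mx 0 j) (fun z => g z i l) x
     - 'D_(delta_mx 0 l) (fun z => g z i j) x).

Definition nabla (Y : 'rV[R]_n) (V : 'rV[R]_n -> 'rV[R]_n) (x : 'rV[R]_n)
    : 'rV[R]_n :=
  \row_k ('D_Y (fun z => V z 0 k) x
          + \sum_(i < n) \sum_(j < n) christoffel x i j k * Y 0 i * V x 0 j).

(* R(d_i, d_j) d_k; the term in the bracket [d_i, d_j] vanishes. *)
Definition curvature (i j k : 'I_n) (x : 'rV[R]_n) : 'rV[R]_n :=
  nabla (delta_mx 0 i) (nabla (delta_mx 0 j) (fun=> delta_mx 0 k)) x
  - nabla (delta_mx 0 j) (nabla (delta_mx 0 i) (fun=> delta_mx 0 k)) x.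

(* R(d_i, d_j) V *)
Definition curvature_op (i j : 'I_n) (x V : 'rV[R]_n) : 'rV[R]_n :=
  \sum_(k < n) V 0 k *: curvature i j k x.

Definition lower (V : 'rV[R]_n -> 'rV[R]_n) (j : 'I_n) (x : 'rV[R]_n) : R :=
  \sum_(k < n) g x j k * V x 0 k.

(* nabla_i V_j, the covariant derivative of the one-form dual to V. *)
Definition nabla_lower (V : 'rV[R]_n -> 'rV[R]_n) (i j : 'I_n)
    (x : 'rV[R]_n) : R :=
  'D_(delta_mx 0 i) (lower V j) x
  - \sum_(k < n) christoffel x i j k * lower V k x.

(* (nabla_i J)(d_j) for a complex valued one-form J; J x Y is the value of J at
   the point x on the vector Y. *)
Definition nabla_form (J : 'rV[R]_n -> 'rV[R]_n -> R[i]) (i j : 'I_n)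
    (x : 'rV[R]_n) : R[i] :=
  cderive (delta_mx 0 i) (fun z => J z (delta_mx 0 j)) x
  - \sum_(k < n) (christoffel x i j k)%:C * J x (delta_mx 0 k).

Definition orthonormal_basis (x : 'rV[R]_n) (e : 'I_n -> 'rV[R]_n) : Prop :=
  forall a b, inner x (e a) (e b) = (a == b)%:R.

(* The sum over a of (nabla_{e_a} J)(e_a). *)
Definition divergence (e : 'I_n -> 'rV[R]_n)
    (J : 'rV[R]_n -> 'rV[R]_n -> R[i]) (x : 'rV[R]_n) : R[i] :=
  \sum_(a < n) \sum_(i < n) \sum_(j < n)
    (e a 0 i * e a 0 j)%:C * nabla_form J i j x.

End LeviCivita.

Definition killing (R : realType) n (N : manifold R n) (g : metric N)
    (X : vector_field N) : Prop :=
  forall b p, dom b p -> forall i j,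
    nabla_lower (g b) (X b) i j (coord b p)
    + nabla_lower (g b) (X b) j i (coord b p) = 0.

Section Spin.
Context {R : realType}.

Definition hdot d (u v : 'cV[R[i]]_d) : R[i] :=
  \sum_(k < d) conjc (u k 0) * v k 0.

(* A module over the complex Clifford algebra of dimension 2 ^ (m %/ 2) is
   irreducible, so this is a complex spinor module (there are two of them up
   to isomorphism for odd m). *)
Record spinor_module (m : nat) := SpinorModule {
  gamma :> 'I_m -> 'M[R[i]]_(2 ^ (m %/ 2));
  gamma_clifford : forall a b,
    gamma a *m gamma b + gamma b *m gamma a = (- 2 * (a == b)%:R)%:M;
  gamma_skew : forall a u v,
    hdot u (gamma a *m v) = - hdot (gamma a *m u) v }.

Definition clifford m (G : spinor_module m) (v : 'rV[R]_m)
    : 'M[R[i]]_(2 ^ (m %/ 2)) :=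
  \sum_(a < m) (v 0 a)%:C *: G a.

(* Spin(m): products of an even number of unit vectors.  The spinor
   representation is faithful on it, so it is realized by matrices. *)
Definition spin_group m (G : spinor_module m)
    (s : 'M[R[i]]_(2 ^ (m %/ 2))) : Prop :=
  exists vs : seq 'rV[R]_m,
    [/\ ~~ odd (size vs),
        forall v, v \in vs -> (v *m v^T) 0 0 = 1
      & s = \big[mulmx/1%:M]_(v <- vs) clifford G v].

(* A spin structure given by a cocycle: [triv] indexes local sections of the
   principal Spin(m)-bundle.  Row a of [frame s x] is the vector e_a, in the
   chart [triv_chart s], of the orthonormal frame below the section s, and
   [lift s t] is the Spin(m)-valued transition function.  A spinor with
   components u in s and v in t satisfies u = lift s t *m v, and [lift_clifford]
   says that lift s t covers the change of frames: h(Y, e_a) are the components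
   of a tangent vector Y in the orthonormal frame. *)
Record spin_structure m (M : manifold R m) (h : metric M)
    (G : spinor_module m) := SpinStructure {
  triv : Type;
  triv_chart : triv -> chart M;
  triv_dom : triv -> set M;
  frame : triv -> 'rV[R]_m -> 'M[R]_m;
  lift : triv -> triv -> M -> 'M[R[i]]_(2 ^ (m %/ 2));
  triv_open : forall s, open (triv_dom s);
  triv_cover : forall p, exists s, triv_dom s p;
  triv_sub : forall s, triv_dom s `<=` dom (triv_chart s);
  frame_smooth : forall s a i,
    smooth_on (coord (triv_chart s) @` triv_dom s) (fun x => frame s x a i);
  frame_orthonormal : forall s p, triv_dom s p ->
    let x := coord (triv_chart s) p in
    orthonormal_basis (h (triv_chart s)) x (fun a => row a (frame s x));
  lift_spin : forall s t p, triv_dom s p -> triv_dom t p ->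
    spin_group G (lift s t p);
  lift_smooth : forall s t i j,
    csmooth_on (coord (triv_chart s) @` (triv_dom s `&` triv_dom t))
      (fun x => lift s t (param (triv_chart s) x) i j);
  lift_cocycle : forall s t u p,
    triv_dom s p -> triv_dom t p -> triv_dom u p ->
    lift s t p *m lift t u p = lift s u p;
  lift_clifford : forall s t p, triv_dom s p -> triv_dom t p ->
    forall Y : 'rV[R]_m,
    let a := triv_chart s in let b := triv_chart t in
    let x := coord a p in let y := coord b p in
    let Y' := Y *m jacobian (transition a b) x in
    clifford G (Y *m h a x *m (frame s x)^T) *m lift s t p =
    lift s t p *m clifford G (Y' *m h b y *m (frame t y)^T) }.

End Spin.

Arguments spinor_module R m : clear implicits.

Section VectorSpinors.
Context {R : realType} {m n : nat}.
Context {M : manifold R m} {N : manifold R n}.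
Context {h : metric M} {G : spinor_module R m}.
Variables (S : spin_structure h G) (phi : M -> N).

(* The coordinate domain on which the trivialization s of the spinor bundle
   and the chart b of N can be used together. *)
Definition local_dom (s : triv S) (b : chart N) : set 'rV[R]_m :=
  coord (triv_chart s) @` (triv_dom s `&` phi @^-1` dom b).

(* A section of the spinor bundle tensored with phi^* TN: column i of
   [vs_comp s b x] is psi^i in the trivialization s, for the coordinate basis
   of the chart b. *)
Record vector_spinor := VectorSpinor {
  vs_comp :> triv S -> chart N -> 'rV[R]_m -> 'M[R[i]]_(2 ^ (m %/ 2), n);
  vs_smooth : forall s b q i,
    csmooth_on (local_dom s b) (fun x => vs_comp s b x q i);
  vs_spin : forall s t b p,
    triv_dom s p -> triv_dom t p -> dom b (phi p) ->
    vs_comp s b (coord (triv_chart s) p) =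
    lift s t p *m vs_comp t b (coord (triv_chart t) p);
  vs_target : forall s b c p,
    triv_dom s p -> dom b (phi p) -> dom c (phi p) ->
    vs_comp s c (coord (triv_chart s) p) =
    vs_comp s b (coord (triv_chart s) p) *m
      map_mx (real_complex R) (jacobian (transition b c) (coord b (phi p))) }.

End VectorSpinors.

(* Everything below is written in a trivialization s of the spinor bundle of M
   and a chart b of N. *)
Section Local.
Context {R : realType} {m n : nat}.
Context {M : manifold R m} {N : manifold R n}.
Context {h : metric M} {G : spinor_module R m}.
Variables (S : spin_structure h G) (g : metric N) (phi : M -> N).
Variables (s : triv S) (b : chart N).

Definition local_map (x : 'rV[R]_m) : 'rV[R]_n :=
  coord b (phi (param (triv_chart s) x)).

Definition e_ (a : 'I_m) (x : 'rV[R]_m) : 'rV[R]_m := row a (frame s x).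

(* Clifford multiplication by the tangent vector Y at x. *)
Definition clifford_mul (x Y : 'rV[R]_m) : 'M[R[i]]_(2 ^ (m %/ 2)) :=
  clifford G (\row_a inner (h (triv_chart s)) x Y (e_ a x)).

Definition dphi (Y x : 'rV[R]_m) : 'rV[R]_n :=
  \row_k 'D_Y (fun z => local_map z 0 k) x.

(* The connection of phi^* TN. *)
Definition nabla_pull (Y : 'rV[R]_m) (V : 'rV[R]_m -> 'rV[R]_n)
    (x : 'rV[R]_m) : 'rV[R]_n :=
  \row_k ('D_Y (fun z => V z 0 k) x
          + \sum_(i < n) \sum_(j < n)
              christoffel (g b) (local_map x) i j k * dphi Y x 0 i * V x 0 j).

Definition tension (x : 'rV[R]_m) : 'rV[R]_n :=
  \sum_(a < m) (nabla_pull (e_ a x) (fun z => dphi (e_ a z) z) x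
                - dphi (nabla (h (triv_chart s)) (e_ a x) (e_ a) x) x).

(* The connection of the tensor product of the spinor bundle and phi^* TN; the
   spin connection is d + 1/4 h(nabla e_a, e_c) e_a . e_c . *)
Definition nabla_twisted (Y : 'rV[R]_m)
    (P : 'rV[R]_m -> 'M[R[i]]_(2 ^ (m %/ 2), n)) (x : 'rV[R]_m)
    : 'M[R[i]]_(2 ^ (m %/ 2), n) :=
  \matrix_(q, k) cderive Y (fun z => P z q k) x
  + \sum_(a < m) \sum_(c < m)
      (4^-1 * inner (h (triv_chart s)) x
                (nabla (h (triv_chart s)) Y (e_ a) x) (e_ c x))%:C
        *: (G a *m G c *m P x)
  + \matrix_(q, k) \sum_(i < n) \sum_(j < n)
      (christoffel (g b) (local_map x) i j k * dphi Y x 0 i)%:C * P x q j.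

Definition dirac (P : 'rV[R]_m -> 'M[R[i]]_(2 ^ (m %/ 2), n))
    (x : 'rV[R]_m) : 'M[R[i]]_(2 ^ (m %/ 2), n) :=
  \sum_(a < m) clifford_mul x (e_ a x) *m nabla_twisted (e_ a x) P x.

Variable psi : vector_spinor S phi.

(* <psi^i, Y . psi^j> *)
Definition spinor_pairing (x Y : 'rV[R]_m) (i j : 'I_n) : R[i] :=
  hdot (col i (psi s b x)) (clifford_mul x Y *m col j (psi s b x)).

Definition spinor_curvature (x : 'rV[R]_m) (k : 'I_n) : R[i] :=
  2^-1 * \sum_(a < m) \sum_(i < n) \sum_(j < n)
    spinor_pairing x (e_ a x) i j *
    (curvature_op (g b) i j (local_map x) (dphi (e_ a x) x) 0 k)%:C.

Variable X : vector_field N.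

Definition current (x Y : 'rV[R]_m) : R[i] :=
  (2 * inner (g b) (local_map x) (dphi Y x) (X b (local_map x)))%:C
  - \sum_(i < n) \sum_(j < n)
      spinor_pairing x Y i j * (nabla_lower (g b) (X b) i j (local_map x))%:C.

End Local.

(* Compared in complex scalars: the curvature term is real because the
   curvature is skew in its first two arguments. *)
Definition dirac_harmonic (R : realType) m n (M : manifold R m)
    (N : manifold R n) (h : metric M) (G : spinor_module R m)
    (S : spin_structure h G) (g : metric N) (phi : M -> N)
    (psi : vector_spinor S phi) : Prop :=
  smooth_map phi /\
  forall (s : triv S) (b : chart N) x, local_dom phi s b x ->
    (forall k,
       (tension g phi s b x 0 k)%:C = spinor_curvature g s b psi x k) /\
    dirac g phi s b (psi s b) x = 0.

(* Main.v *)
Require Import Defs.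
From mathcomp Require Import ring lra.

(** The divergence does not depend on the orthonormal basis, so it is the sum of
    [d_{e_a} (J (e_a)) - J (nabla_{e_a} e_a)] over the frame [e_a] below a local
    section of the spin structure.

    In the first half of [J] the skewness of [A_ij := nabla_i X_j] kills the
    derivative of [X], and twice the pairing of [X] with the tension field is
    left.  In the second half, [J_a = tr (Psi^* G_a Psi A^T)] with [Psi] the
    matrix of components of the spinor; the Dirac equation and the skewness of
    the [G_a] leave [<psi^i, e_a . psi^j> nabla_{dphi (e_a)} A_ij].  For a
    Killing field, [nabla_k nabla_i X_j = <R(d_i, d_j) d_k, X>]: the Ricci
    identity and the first Bianchi identity, together with the skewness of [A],
    suffice for this.  So the two halves cancel by the equation for the tension
    field. *)

Set Implicit Arguments.
Unset Strict Implicit.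
Unset Printing Implicit Defensive.

Local Open Scope classical_set_scope.
Local Open Scope ring_scope.
Local Open Scope complex_scope.

(** * Second derivatives commute *)

(** No coordinates or frames adapted to the point are used, so Christoffel symbols and connection
    coefficients are carried along and have to cancel algebraically. The frame of the spin structure
    is convenient because Clifford multiplication by e_a is there the constant matrix [G a], and
    derivatives only meet the spinor and A. The price is the term in nabla_{e_a} e_a. The spin
    connection pays it: its commutator with [G a] is the sum over c of h(nabla_{e_a} e_a, e_c)
    [G c], with the very same coefficients. The spinor half is written with matrices and traces,
    where adjoints and cyclicity replace index manipulations. The analytic core is the symmetry of
    second derivatives, needed for the Ricci identity of the one-form dual to X. It is proved from
    differentiability of the first derivatives at the point, so that everything can be stated at a
    single x with hypotheses near x. *)

Section Differentiability.
Context {R : realType} {V W : normedModType R}.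
Implicit Types (f g : V -> W) (x u v : V).

(** Rules of differentiation identify a derivative only near a point; differentiating once more
    therefore requires that differentiability depend on the germ alone. *)
Lemma near_eq_differentiable f g x :
  {near x, f =1 g} -> differentiable f x -> differentiable g x.
Proof.
move=> fg df; have fgx : f x = g x := nbhs_singleton fg.
have cdf := diff_continuous df.
have dg : g \o shift x = cst (g x) + 'd f x +o_ 0 id.
  apply/eqaddoP => _/posnumP[e].
  have /eqaddoP/(_ _ (gt0 e)) := diff_locally df.
  have : \forall h \near (0 : V), f (h + x) = g (h + x).
    by move: fg; rewrite (near_shift 0)/= subr0.
  apply: filterS2 => h /= fgh; rewrite -fgx.
  by rewrite /shift /= !fctE /= fgh.
have dgE := diff_unique cdf dg.
by apply/diff_locallyP; rewrite dgE.
Qed.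

Lemma is_derive_line f y u (s : R) : derivable f (s *: u + y) u ->
  is_derive s 1 (fun t : R => f (t *: u + y)) ('D_u f (s *: u + y)).
Proof.
have E : (fun h : R => h^-1 *:
      (((fun t : R => f (t *: u + y)) \o shift s) (h *: 1) - f (s *: u + y))) =
    (fun h : R => h^-1 *: ((f \o shift (s *: u + y)) (h *: u) - f (s *: u + y))).
  by apply/funext => h /=; rewrite [_%:A]mulr1 scalerDl addrA.
move=> fu; apply: DeriveDef; first by rewrite /derivable E.
by rewrite /derive E.
Qed.

Lemma differentiable_approx f x : differentiable f x ->
  forall e : R, 0 < e -> exists2 d : R, 0 < d &
  forall h, `|h| < d -> `|f (h + x) - f x - 'd f x h| <= e * `|h|.
Proof.
move=> df e e0; have /eqaddoP/(_ _ e0)/nbhs_ballP[d /= d0 H] := diff_locally df.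
exists d => // h hd; have /= := H h; rewrite -ball_normE /= sub0r normrN.
move=> /(_ hd); by rewrite /shift /= !fctE opprD addrA.
Qed.

End Differentiability.

Section Young.
Context {R : realType} {V : normedModType R}.
Implicit Types (f : V -> R) (x u v : V).

(** The mean value theorem along u turns the second difference into t times the increment of
    ['D_u f] from c u + x to c u + t v + x, for some c between 0 and t. The linear approximation of
    ['D_u f] at x is applied at both points; its values at c u cancel, so the unknown c drops
    out. *)
Lemma second_difference_approx f x u v :
  (\forall z \near x, differentiable f z) ->
  differentiable ('D_u f) x -> forall e : R, 0 < e ->
  exists2 d : R, 0 < d & forall t : R, 0 < t < d ->
  `|f (t *: u + (t *: v + x)) - f (t *: u + x) - f (t *: v + x) + f x
    - t ^+ 2 * 'D_v ('D_u f) x| <= e * t ^+ 2.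
Proof.
move=> /nbhs_ballP[r /= r0 fr] dg e e0.
(* The two remainders are at most e / K times t (|u| + |v|) and t |u|, which add up to less than t
   K; the 1 keeps K positive when u = v = 0. *)
pose K : R := 2 * `|u| + `|v| + 1.
have K0 : 0 < K by rewrite /K; have := normr_ge0 u; have := normr_ge0 v; lra.
have eK0 : 0 < e / K by rewrite divr_gt0.
have [d d0 H] := differentiable_approx dg eK0.
exists (Num.min (r / K) (d / K)); first by rewrite lt_min !divr_gt0.
move=> t /andP[t0]; rewrite lt_min !ltr_pdivlMr// => /andP[tr td].
have small (c : R) w : 0 <= c <= t -> w = 0 \/ w = t *: v ->
    `|c *: u + w| <= t * K /\ `|c *: u + w| <= t * (`|u| + `|v|).
  move=> /andP[c0 ct] cw.
  have h1 : `|c *: u + w| <= t * (`|u| + `|v|).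
    apply: le_trans (ler_normD _ _) _; rewrite mulrDr normrZ ger0_norm //.
    apply: lerD; first by apply: ler_wpM2r.
    case: cw => ->; first by rewrite normr0 mulr_ge0 // ltW.
    by rewrite normrZ gtr0_norm.
  split=> //; apply: le_trans h1 _; apply: ler_wpM2l; first exact: ltW.
  by rewrite /K; have := normr_ge0 u; lra.
have fd (c : R) w : 0 <= c <= t -> w = 0 \/ w = t *: v ->
    differentiable f (c *: u + (w + x)).
  move=> cc cw; apply: fr; rewrite -ball_normE /=.
  rewrite addrA opprD addrA addrAC subrr add0r normrN.
  by case: (small c w cc cw) => [/le_lt_trans->].
have L w : w = 0 \/ w = t *: v -> forall c : R, 0 <= c <= t ->
    is_derive c 1 (fun s : R => f (s *: u + (w + x))) ('D_u f (c *: u + (w + x))).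
  by move=> cw c cc; apply: is_derive_line; apply: diff_derivable; exact: fd.
pose F s := f (s *: u + (t *: v + x)) - f (s *: u + (0 + x)).
have dF (c : R) : 0 <= c <= t ->
   is_derive c 1 F ('D_u f (c *: u + (t *: v + x)) - 'D_u f (c *: u + (0 + x))).
  by move=> cc; apply: is_deriveB; apply: L => //; [right|left].
have [] := @MVT _ F (fun c =>
  'D_u f (c *: u + (t *: v + x)) - 'D_u f (c *: u + (0 + x))) 0 t t0.
- by move=> c; rewrite in_itv /= => /andP[c0 ct]; apply: dF; rewrite !ltW.
- apply: derivable_within_continuous => c; rewrite in_itv /= => cc.
  by have [] := dF c cc.
move=> c; rewrite in_itv /= => /andP[c0 ct].
rewrite /F !scale0r !add0r subr0 => E.
have cc : 0 <= c <= t by rewrite !ltW.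
have [h1 h1'] := small c (t *: v) cc (or_intror erefl).
have [h2 h2'] := small c 0 cc (or_introl erefl).
have {}h2 := H _ (le_lt_trans h2 td); have {}h1 := H _ (le_lt_trans h1 td).
rewrite addr0 in h2 h2'; rewrite -(addrA (c *: u)) in h1.
rewrite deriveE //.
set a := f _ in E *; set b := f _ in E *; set a' := f _ in E *; set b' := f x in E *.
have -> : a - b - a' + b' = (a - b + b') - a' by ring.
have {}E : a - b + b' - a' = ('D_u f (c *: u + (t *: v + x)) - 'D_u f (c *: u + x)) * t.
  by rewrite -E; ring.
rewrite E.
have {E}-> : ('D_u f (c *: u + (t *: v + x)) - 'D_u f (c *: u + x)) * t
    - t ^+ 2 * 'd ('D_u f) x v
 = t * (('D_u f (c *: u + (t *: v + x)) - 'D_u f x - 'd ('D_u f) x (c *: u + t *: v))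
    - ('D_u f (c *: u + x) - 'D_u f x - 'd ('D_u f) x (c *: u))).
  have -> : 'd ('D_u f) x (c *: u + t *: v) =
      'd ('D_u f) x (c *: u) + t * 'd ('D_u f) x v.
    by rewrite linearD [X in _ + X]linearZ.
  ring.
rewrite normrM gtr0_norm // expr2 mulrCA ler_pM2l //.
apply: le_trans (ler_normB _ _) _.
apply: le_trans (lerD h1 h2) _; rewrite -mulrDr.
have -> : e * t = e / K * (t * K) by field; rewrite gt_eqF.
rewrite ler_pM2l //; apply: le_trans (lerD h1' (_ : _ <= t * `|u|)) _.
  by rewrite normrZ ger0_norm ?ler_wpM2r // ltW.
rewrite -mulrDr ler_pM2l // /K; lra.
Qed.

(** Young's form of the symmetry theorem: the second difference is symmetric in u and v, so both
    iterated derivatives approximate it within e / 2 times t ^ 2 for the same small t. *)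
Theorem derive_commute f x u v :
  (\forall z \near x, differentiable f z) ->
  differentiable ('D_u f) x -> differentiable ('D_v f) x ->
  'D_v ('D_u f) x = 'D_u ('D_v f) x.
Proof.
move=> df du dv; apply/subr0_eq/eqP; rewrite -normr_le0; apply/ler_addgt0Pr => e e0.
rewrite add0r.
have e2 : 0 < e / 2 by rewrite divr_gt0.
have [d1 d10 H1] := second_difference_approx v df du e2.
have [d2 d20 H2] := second_difference_approx u df dv e2.
pose t := Num.min d1 d2 / 2.
have m0 : 0 < Num.min d1 d2 by rewrite lt_min d10.
have [t1 t2] : t < d1 /\ t < d2.
  have : t < Num.min d1 d2 by rewrite /t; lra.
  by rewrite lt_min => /andP[].
have t0 : 0 < t by rewrite divr_gt0.
have t20 : 0 < t ^+ 2 by rewrite exprn_gt0.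
have {}H1 := H1 t; have {}H2 := H2 t.
move: H1 H2; rewrite t0 t1 t2 => /(_ isT) H1 /(_ isT).
rewrite (addrCA (t *: v)); move: H1 t20.
move: ('D_v _ _) ('D_u _ _) (f (_ + _)) (f (_ + _)) (f (_ + _)) (f x).
move: (t ^+ 2) => T a b A B C D H1 T0 H2; rewrite -(ler_pM2l T0).
rewrite -{1}(gtr0_norm T0) -normrM ler_norml mulrBr.
by move: H1 H2; rewrite !ler_norml => /andP[? ?] /andP[? ?]; apply/andP; split; lra.
Qed.

End Young.

(** * Rules of differentiation *)

Section RealCalculus.
Context {R : realType} {V : normedModType R}.
Implicit Types (f g : V -> R) (x v : V).

Lemma differentiable_bigsum (I : Type) (r : seq I) (P : pred I)
    (F : I -> V -> R) x : (forall i, differentiable (F i) x) ->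
  differentiable (fun z => \sum_(i <- r | P i) F i z) x.
Proof.
move=> dF; rewrite -fct_sumE.
by elim/big_ind: _ => // *; exact: differentiableD.
Qed.

Lemma differentiable_bigprod (I : Type) (r : seq I) (P : pred I)
    (F : I -> V -> R) x : (forall i, differentiable (F i) x) ->
  differentiable (fun z => \prod_(i <- r | P i) F i z) x.
Proof.
move=> dF; elim: r => [|i r IH].
  under eq_fun do rewrite big_nil; exact: differentiable_cst.
under eq_fun do rewrite big_cons; case: (P i) => //.
exact: differentiableM.
Qed.

Lemma derive_add f g x v : differentiable f x -> differentiable g x ->
  'D_v (fun z => f z + g z) x = 'D_v f x + 'D_v g x.
Proof. by move=> df dg; apply: deriveD; apply: diff_derivable. Qed.

Lemma derive_sub f g x v : differentiable f x -> differentiable g x ->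
  'D_v (fun z => f z - g z) x = 'D_v f x - 'D_v g x.
Proof. by move=> df dg; apply: deriveB; apply: diff_derivable. Qed.

Lemma derive_opp f x v : differentiable f x ->
  'D_v (fun z => - f z) x = - 'D_v f x.
Proof. by move=> df; apply: deriveN; apply: diff_derivable. Qed.

Lemma derive_mul f g x v : differentiable f x -> differentiable g x ->
  'D_v (fun z => f z * g z) x = 'D_v f x * g x + f x * 'D_v g x.
Proof.
move=> df dg; have := deriveM (diff_derivable (v:=v) df) (diff_derivable (v:=v) dg).
by rewrite addrC => ->; congr (_ + _); rewrite [RHS]mulrC.
Qed.

Lemma derive_scale (c : R) f x v :
  differentiable f x -> 'D_v (fun z => c * f z) x = c * 'D_v f x.
Proof.
move=> df; rewrite (derive_mul _ _ df); last exact: (@differentiable_cst _ _ R).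
by rewrite (derive_cst _ x v) mul0r add0r.
Qed.

Lemma derive_bigsum (I : Type) (r : seq I) (F : I -> V -> R) x v :
  (forall i, differentiable (F i) x) ->
  'D_v (fun z => \sum_(i <- r) F i z) x = \sum_(i <- r) 'D_v (F i) x.
Proof.
move=> dF; elim: r => [|i r IH].
  by rewrite big_nil; under eq_fun do rewrite big_nil; exact: derive_cst.
under eq_fun do rewrite big_cons.
by rewrite derive_add ?big_cons ?IH //; exact: differentiable_bigsum.
Qed.

Lemma differentiable_det n (A : V -> 'M[R]_n) x :
  (forall i j, differentiable (fun z => A z i j) x) ->
  differentiable (fun z => \det (A z)) x.
Proof.
move=> dA; apply: differentiable_bigsum => s.
apply: differentiableM; first exact: differentiable_cst.
exact: differentiable_bigprod.
Qed.

(** Cramer's rule. It computes [invmx] only where the matrix is invertible, since a singular matrix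
    is its own [invmx]. *)
Lemma differentiable_invmx n (A : V -> 'M[R]_n) x :
  (\forall z \near x, A z \in unitmx) ->
  (forall i j, differentiable (fun z => A z i j) x) ->
  forall i j, differentiable (fun z => invmx (A z) i j) x.
Proof.
move=> uA dA i j.
apply: (@near_eq_differentiable _ _ _ (fun z => (\det (A z))^-1 * cofactor (A z) j i)).
  by apply: filterS uA => z uz; rewrite /invmx uz !mxE.
apply: differentiableM.
  apply: differentiableV; first exact: differentiable_det.
  by have := nbhs_singleton uA; rewrite unitmxE unitfE.
apply: differentiableM; first exact: differentiable_cst.
apply: differentiable_det => k l; under eq_fun do rewrite !mxE; exact: dA.
Qed.

End RealCalculus.

Section RowCalculus.
Context {R : realType} {m : nat}.
Implicit Types (x v : 'rV[R]_m).

Lemma derive_row_expand (f : 'rV[R]_m -> R) x v : differentiable f x ->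
  'D_v f x = \sum_i v 0 i * 'D_(delta_mx 0 i) f x.
Proof.
move=> df; rewrite deriveE // {1}(row_sum_delta v) linear_sum /=.
by apply: eq_bigr => i _; rewrite linearZ /= deriveE.
Qed.

Lemma differentiable_row (V : normedModType R) n (F : V -> 'rV[R]_n) (x : V) :
  (forall k, differentiable (fun z => F z 0 k) x) -> differentiable F x.
Proof.
move=> dF.
have -> : F = \sum_k (fun z => F z 0 k *: delta_mx 0 k).
  by apply/funext => z; rewrite fct_sumE -row_sum_delta.
by apply: differentiable_sum => k; exact: differentiableZl.
Qed.

End RowCalculus.

Section Chain.
Context {R : realType} {V : normedModType R}.
Variables (n : nat) (F : V -> 'rV[R]_n) (f : 'rV[R]_n -> R) (x : V).
Hypothesis dF : forall k, differentiable (fun z => F z 0 k) x.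
Hypothesis df : differentiable f (F x).

Lemma differentiable_comp_row : differentiable (fun z => f (F z)) x.
Proof. by apply: differentiable_comp => //; exact: differentiable_row. Qed.

Lemma derive_comp_row (v : V) : 'D_v (fun z => f (F z)) x =
  \sum_k 'D_v (fun z => F z 0 k) x * 'D_(delta_mx 0 k) f (F x).
Proof.
have dFx := differentiable_row dF.
rewrite deriveE; last exact: differentiable_comp_row.
rewrite diff_comp //= -(deriveE ('d F x v) df) (derive_row_expand _ df).
apply: eq_bigr => k _.
congr (_ * _); rewrite -deriveE // derive_mx; last exact: diff_derivable.
by rewrite mxE.
Qed.

End Chain.

Section ComplexCalculus.
Context {R : realType} {m : nat}.
Implicit Types (f g : 'rV[R]_m -> R[i]) (x v : 'rV[R]_m).

(** Real differentiability, componentwise like [cderive]; conjugation, which the hermitian product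
    brings in, preserves it. *)
Definition cdifferentiable f x :=
  differentiable (fun z => complex.Re (f z)) x /\
  differentiable (fun z => complex.Im (f z)) x.

Lemma near_eq_cderive f g x v : {near x, f =1 g} ->
  cderive v f x = cderive v g x.
Proof.
by move=> fg; congr (_ +i* _); apply: near_eq_derive; apply: filterS fg => z ->.
Qed.

Lemma ReD (a b : R[i]) : complex.Re (a + b) = complex.Re a + complex.Re b.
Proof. by case: a; case: b. Qed.
Lemma ImD (a b : R[i]) : complex.Im (a + b) = complex.Im a + complex.Im b.
Proof. by case: a; case: b. Qed.
Lemma ReN (a : R[i]) : complex.Re (- a) = - complex.Re a.
Proof. by case: a. Qed.
Lemma ImN (a : R[i]) : complex.Im (- a) = - complex.Im a.
Proof. by case: a. Qed.
Lemma ReM (a b : R[i]) : complex.Re (a * b) =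
  complex.Re a * complex.Re b - complex.Im a * complex.Im b.
Proof. by case: a; case: b. Qed.
Lemma ImM (a b : R[i]) : complex.Im (a * b) =
  complex.Re a * complex.Im b + complex.Im a * complex.Re b.
Proof. by case: a; case: b. Qed.

Lemma cdifferentiable_cst c x : cdifferentiable (fun=> c) x.
Proof. by split; exact: differentiable_cst. Qed.

Lemma cdifferentiableD f g x : cdifferentiable f x -> cdifferentiable g x ->
  cdifferentiable (fun z => f z + g z) x.
Proof.
move=> [? ?] [? ?]; split.
  under eq_fun do rewrite ReD; exact: differentiableD.
under eq_fun do rewrite ImD; exact: differentiableD.
Qed.

Lemma cdifferentiableN f x : cdifferentiable f x ->
  cdifferentiable (fun z => - f z) x.
Proof.
move=> [? ?]; split.
  under eq_fun do rewrite ReN; exact: differentiableN.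
under eq_fun do rewrite ImN; exact: differentiableN.
Qed.

Lemma cdifferentiableM f g x : cdifferentiable f x -> cdifferentiable g x ->
  cdifferentiable (fun z => f z * g z) x.
Proof.
move=> [? ?] [? ?]; split.
  under eq_fun do rewrite ReM.
  by apply: differentiableB; apply: differentiableM.
under eq_fun do rewrite ImM.
by apply: differentiableD; apply: differentiableM.
Qed.

Lemma cdifferentiable_real (f : 'rV[R]_m -> R) x : differentiable f x ->
  cdifferentiable (fun z => (f z)%:C) x.
Proof. by move=> df; split=> //; exact: differentiable_cst. Qed.

Lemma cdifferentiable_conj f x : cdifferentiable f x ->
  cdifferentiable (fun z => conjc (f z)) x.
Proof.
move=> [df df']; split.
  by congr (differentiable _ x): df; apply/funext => z; case: (f z).
rewrite [X in differentiable X _](_ : _ = fun z => - complex.Im (f z)).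
  exact: differentiableN.
by apply/funext => z; case: (f z).
Qed.

Lemma cdifferentiable_sum (I : Type) (r : seq I) (F : I -> 'rV[R]_m -> R[i]) x :
  (forall i, cdifferentiable (F i) x) ->
  cdifferentiable (fun z => \sum_(i <- r) F i z) x.
Proof.
move=> dF; elim: r => [|i r IH].
  under eq_fun do rewrite big_nil; exact: cdifferentiable_cst.
under eq_fun do rewrite big_cons; exact: cdifferentiableD.
Qed.

Lemma cderiveE (a b : 'rV[R]_m -> R) f v x :
  (forall z, complex.Re (f z) = a z) -> (forall z, complex.Im (f z) = b z) ->
  cderive v f x = 'D_v a x +i* 'D_v b x.
Proof. by move=> /funext Ea /funext Eb; rewrite /cderive Ea Eb. Qed.

Lemma cderive_cst c x v : cderive v (fun=> c) x = 0.
Proof. by rewrite /cderive !(derive_cst _ x v). Qed.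

Lemma cderiveD f g x v : cdifferentiable f x -> cdifferentiable g x ->
  cderive v (fun z => f z + g z) x = cderive v f x + cderive v g x.
Proof.
move=> [? ?] [? ?]; rewrite (cderiveE v x (fun z => ReD _ _) (fun z => ImD _ _)).
by rewrite !derive_add.
Qed.

Lemma cderiveN f x v : cdifferentiable f x ->
  cderive v (fun z => - f z) x = - cderive v f x.
Proof.
move=> [? ?]; rewrite (cderiveE v x (fun z => ReN _) (fun z => ImN _)).
by rewrite !derive_opp.
Qed.

Lemma cderiveM f g x v : cdifferentiable f x -> cdifferentiable g x ->
  cderive v (fun z => f z * g z) x = cderive v f x * g x + f x * cderive v g x.
Proof.
move=> [? ?] [? ?]; rewrite (cderiveE v x (fun z => ReM _ _) (fun z => ImM _ _)).
rewrite derive_sub ?derive_add ?derive_mul //; try exact: differentiableM.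
by apply/eqP; rewrite eq_complex !(ReD, ImD, ReM, ImM) /=; apply/andP; split;
  apply/eqP; ring.
Qed.

Lemma cderive_real (f : 'rV[R]_m -> R) x v :
  cderive v (fun z => (f z)%:C) x = ('D_v f x)%:C.
Proof. by rewrite /cderive /= (derive_cst _ x v). Qed.

Lemma cderive_conj f x v : cdifferentiable f x ->
  cderive v (fun z => conjc (f z)) x = conjc (cderive v f x).
Proof.
move=> [? ?]; rewrite /cderive /=; congr (_ +i* _).
  by congr ('D_v _ x); apply/funext => z; case: (f z).
rewrite -derive_opp //.
by congr ('D_v _ x); apply/funext => z; case: (f z).
Qed.

Lemma cderive_sum (I : Type) (r : seq I) (F : I -> 'rV[R]_m -> R[i]) x v :
  (forall i, cdifferentiable (F i) x) ->
  cderive v (fun z => \sum_(i <- r) F i z) x = \sum_(i <- r) cderive v (F i) x.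
Proof.
move=> dF; elim: r => [|i r IH].
  by rewrite big_nil; under eq_fun do rewrite big_nil; exact: cderive_cst.
under eq_fun do rewrite big_cons.
by rewrite cderiveD ?big_cons ?IH //; exact: cdifferentiable_sum.
Qed.

Lemma cderive_expand f x v : cdifferentiable f x ->
  cderive v f x = \sum_i (v 0 i)%:C * cderive (delta_mx 0 i) f x.
Proof.
move=> [df df']; rewrite /cderive !(derive_row_expand v) //.
apply/eqP; rewrite eq_complex /=; apply/andP; split; apply/eqP.
  rewrite (big_morph _ ReD (erefl : complex.Re 0 = 0)); apply: eq_bigr => i _.
  by rewrite ReM /= mul0r subr0.
rewrite (big_morph _ ImD (erefl : complex.Im 0 = 0)); apply: eq_bigr => i _.
by rewrite ImM /= mul0r addr0.
Qed.

End ComplexCalculus.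

(** * Killing fields and curvature *)

Section TwiceDifferentiable.
Context {R : realType} {n : nat}.
Implicit Types (f g : 'rV[R]_n -> R) (x : 'rV[R]_n).

(** The hypotheses of [derive_commute] in the coordinate directions: a condition at one point,
    inherited by the sums of products that lower an index. *)
Definition twice_differentiable f x :=
  (\forall z \near x, differentiable f z) /\
  forall i, differentiable ('D_(delta_mx 0 i) f) x.

Lemma twice_differentiableW f x : twice_differentiable f x -> differentiable f x.
Proof. by move=> [/nbhs_singleton]. Qed.

Lemma smooth_on_twice_differentiable (U : set 'rV[R]_n) f x :
  open U -> U x -> smooth_on U f -> twice_differentiable f x.
Proof.
move=> oU Ux /(_ 2%N) [df d2f]; split=> [|i]; last by have [+ _] := d2f i; apply.
by have := open_nbhs_nbhs (conj oU Ux); apply: filterS.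
Qed.

Lemma twice_differentiableM f g x :
  twice_differentiable f x -> twice_differentiable g x ->
  twice_differentiable (fun z => f z * g z) x.
Proof.
move=> [nf df] [ng dg]; split=> [|i].
  by apply: filterS2 nf ng => z; exact: differentiableM.
have fg : {near x, (fun z => 'D_(delta_mx 0 i) f z * g z + f z * 'D_(delta_mx 0 i) g z)
   =1 'D_(delta_mx 0 i) (fun z => f z * g z)}.
  by apply: filterS2 nf ng => z fz gz; rewrite derive_mul.
apply: near_eq_differentiable fg _.
have dfx := nbhs_singleton nf; have dgx := nbhs_singleton ng.
by apply: differentiableD; apply: differentiableM.
Qed.

Lemma twice_differentiable_sum k (F : 'I_k -> 'rV[R]_n -> R) x :
  (forall i, twice_differentiable (F i) x) ->
  twice_differentiable (fun z => \sum_i F i z) x.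
Proof.
move=> dF.
have nF : \forall z \near x, forall i, differentiable (F i) z.
  exact: (@filter_forall _ _ (fun i z => differentiable (F i) z) _
    (nbhs_filter x) (fun i => (dF i).1)).
split=> [|i]; first by apply: filterS nF => z; exact: differentiable_bigsum.
have FE : {near x, (fun z => \sum_j 'D_(delta_mx 0 i) (F j) z)
   =1 'D_(delta_mx 0 i) (fun z => \sum_j F j z)}.
  by apply: filterS nF => z dz; rewrite derive_bigsum.
apply: near_eq_differentiable FE _.
by apply: differentiable_bigsum => j; have [] := dF j.
Qed.

Lemma twice_differentiable_commute f x i j : twice_differentiable f x ->
  'D_(delta_mx 0 i) ('D_(delta_mx 0 j) f) x =
  'D_(delta_mx 0 j) ('D_(delta_mx 0 i) f) x.
Proof. by move=> [nf df]; exact: derive_commute. Qed.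

End TwiceDifferentiable.

(** The Ricci identity as a formal identity: [x] and [dx] stand for the components of a one-form and
    their first derivatives, [G] and [dG] for the Christoffel symbols and theirs, and [c] for the
    common value of the two mixed second derivatives. The terms in [dx] cancel, and what multiplies
    [x] is the curvature. *)
Lemma ricci_algebra (R : comNzRingType) (n : nat) (x : 'I_n -> R)
    (dx : 'I_n -> 'I_n -> R) (G : 'I_n -> 'I_n -> 'I_n -> R)
    (dG : 'I_n -> 'I_n -> 'I_n -> 'I_n -> R) (c : R) (k i j : 'I_n) :
  (forall l, G i k l = G k i l) ->
  let A a b := dx a b - \sum_l G a b l * x l in
  let T a b := c - (\sum_l dG a b j l * x l + \sum_l G b j l * dx a l)
    - \sum_l G a b l * A l j - \sum_l G a j l * A b l in
  T k i - T i k =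
  - \sum_l x l * (dG k i j l + \sum_q G k q l * G i j q
                  - (dG i k j l + \sum_q G i q l * G k j q)).
Proof.
move=> Gs A T; rewrite /T.
have A2 a b e : \sum_l G a b l * A e l =
    \sum_l G a b l * dx e l - \sum_l x l * \sum_q G e q l * G a b q.
  under [X in _ - X]eq_bigr do rewrite mulr_sumr.
  rewrite exchange_big /= -sumrB; apply: eq_bigr => l _.
  rewrite mulrBr mulr_sumr; congr (_ - _); apply: eq_bigr => q _; ring.
rewrite (A2 k j i) (A2 i j k).
have -> : \sum_l G i k l * A l j = \sum_l G k i l * A l j.
  by apply: eq_bigr => l _; rewrite Gs.
under [X in _ = - X]eq_bigr do rewrite mulrBr !mulrDr.
rewrite sumrB !big_split /=.
have C a b : \sum_l x l * dG a b j l = \sum_l dG a b j l * x l.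
  by apply: eq_bigr => l _; rewrite mulrC.
rewrite !C; ring.
Qed.

Section Curvature.
Context {R : realType} {n : nat}.
Variable g : 'rV[R]_n -> 'M[R]_n.
Implicit Types (i j k l : 'I_n) (x : 'rV[R]_n).

Lemma christoffel_sym x i j k : (\forall z \near x, (g z)^T = g z) ->
  christoffel g x i j k = christoffel g x j i k.
Proof.
move=> gs; rewrite /christoffel; congr (_ * _); apply: eq_bigr => l _.
rewrite (@near_eq_derive _ _ _ (fun z => g z i j) (fun z => g z j i)); last first.
  by apply: filterS gs => z gz; rewrite -[in LHS]gz mxE.
by rewrite [X in _ * (X - _)]addrC.
Qed.

Lemma differentiable_christoffel x i j k :
  (\forall z \near x, g z \in unitmx) ->
  (forall i j, twice_differentiable (fun z => g z i j) x) ->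
  differentiable (fun z => christoffel g z i j k) x.
Proof.
move=> gu dg; apply: differentiableM; first exact: differentiable_cst.
apply: differentiable_bigsum => l; apply: differentiableM.
  by apply: differentiable_invmx => // a b; exact: twice_differentiableW.
apply: differentiableB; last by have [] := dg i j.
by apply: differentiableD; [have [] := dg j l|have [] := dg i l].
Qed.

Lemma nabla_delta x i j k :
  nabla g (delta_mx 0 i) (fun=> delta_mx 0 j) x 0 k = christoffel g x i j k.
Proof.
rewrite mxE derive_cst add0r (bigD1 i) //= [X in _ + X]big1 ?addr0; last first.
  move=> p /negbTE pi; apply: big1 => q _.
  by rewrite mxE pi andbF mulr0 mul0r.
rewrite (bigD1 j) //= big1 ?addr0; last first.
  by move=> q /negbTE qj; rewrite !mxE qj andbF mulr0.
by rewrite !mxE !eqxx !mulr1.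
Qed.

Lemma curvatureE x i j k l : curvature g i j k x 0 l =
  'D_(delta_mx 0 i) (fun z => christoffel g z j k l) x
  + \sum_q christoffel g x i q l * christoffel g x j k q
  - ('D_(delta_mx 0 j) (fun z => christoffel g z i k l) x
  + \sum_q christoffel g x j q l * christoffel g x i k q).
Proof.
have E i1 j1 : nabla g (delta_mx 0 i1) (nabla g (delta_mx 0 j1)
      (fun=> delta_mx 0 k)) x 0 l =
    'D_(delta_mx 0 i1) (fun z => christoffel g z j1 k l) x
    + \sum_q christoffel g x i1 q l * christoffel g x j1 k q.
  rewrite mxE; under eq_fun do rewrite nabla_delta.
  congr (_ + _); rewrite (bigD1 i1) //= [X in _ + X]big1 ?addr0; last first.
    move=> p /negbTE pi; apply: big1 => q _.
    by rewrite mxE pi andbF mulr0 mul0r.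
  by apply: eq_bigr => q _; rewrite nabla_delta mxE !eqxx mulr1.
by rewrite /curvature mxE E [X in _ + X]mxE E.
Qed.

Variables (X : 'rV[R]_n -> 'rV[R]_n) (y : 'rV[R]_n).
Hypothesis gu : \forall z \near y, g z \in unitmx.
Hypothesis gs : \forall z \near y, (g z)^T = g z.
Hypothesis dg : forall i j, twice_differentiable (fun z => g z i j) y.
Hypothesis dX : forall k, twice_differentiable (fun z => X z 0 k) y.

(** The second covariant derivative of the dual one-form, with [k] the outer direction; the two sums
    correct the two slots of the tensor [nabla_lower g X]. *)
Definition nabla2_lower k i j : R :=
  'D_(delta_mx 0 k) (nabla_lower g X i j) y
  - \sum_l christoffel g y k i l * nabla_lower g X l j y
  - \sum_l christoffel g y k j l * nabla_lower g X i l y.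

Lemma twice_differentiable_lower j : twice_differentiable (lower g X j) y.
Proof. by apply: twice_differentiable_sum => k; exact: twice_differentiableM. Qed.

Let dGam i j k := differentiable_christoffel i j k gu dg.
Let dlow j : differentiable (lower g X j) y :=
  twice_differentiableW (twice_differentiable_lower j).

Lemma differentiable_nabla_lower i j : differentiable (nabla_lower g X i j) y.
Proof.
apply: differentiableB; first by have [] := twice_differentiable_lower j.
by apply: differentiable_bigsum => k; exact: differentiableM.
Qed.

Lemma derive_nabla_lower k i j : 'D_(delta_mx 0 k) (nabla_lower g X i j) y =
  'D_(delta_mx 0 k) ('D_(delta_mx 0 i) (lower g X j)) y
  - (\sum_l 'D_(delta_mx 0 k) (fun z => christoffel g z i j l) y * lower g X l y
     + \sum_l christoffel g y i j l * 'D_(delta_mx 0 k) (lower g X l) y).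
Proof.
have [_ /(_ i) d2] := twice_differentiable_lower j.
have dsum l : differentiable (fun z => christoffel g z i j l * lower g X l z) y.
  exact: differentiableM.
rewrite derive_sub //; last exact: differentiable_bigsum.
rewrite derive_bigsum // -big_split /=; congr (_ - _); apply: eq_bigr => l _.
by rewrite derive_mul.
Qed.

(** Symmetry of second derivatives supplies the common [c] of [ricci_algebra]. The minus sign is
    that of the curvature acting on one-forms. *)
Lemma ricci_lower k i j : nabla2_lower k i j - nabla2_lower i k j =
  - \sum_l lower g X l y * curvature g k i j y 0 l.
Proof.
rewrite /nabla2_lower !derive_nabla_lower.
rewrite (twice_differentiable_commute i k (twice_differentiable_lower j)).
under [X in _ = - X]eq_bigr do rewrite curvatureE.
exact (@ricci_algebra R n (fun l => lower g X l y)
  (fun a l => 'D_(delta_mx 0 a) (lower g X l) y) (christoffel g y)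
  (fun a b l c => 'D_(delta_mx 0 a) (fun z => christoffel g z b l c) y)
  _ k i j (fun l => christoffel_sym i k l gs)).
Qed.

(** Torsion-freeness: in [curvatureE] the derivative terms and the quadratic terms are symmetric in
    their last two indices, so the cyclic sum pairs each of them with its negative. *)
Lemma bianchi i j k l : curvature g i j k y 0 l + curvature g j k i y 0 l
  + curvature g k i j y 0 l = 0.
Proof.
(* The symmetry of the Christoffel symbols is differentiated at [y], so it must hold at every nearby
   z, and at z it requires the symmetry of [g] near z. *)
have gnear : \forall z \near y, \forall w \near z, (g w)^T = g w.
  exact: nbhs_interior gs.
pose D a b c := 'D_(delta_mx 0 a) (fun z => christoffel g z b c l) y.
pose Q a b c := \sum_q christoffel g y a q l * christoffel g y b c q.
have DS a b c : D a b c = D a c b.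
  by apply: near_eq_derive; apply: filterS gnear => z gz; exact: christoffel_sym.
have QS a b c : Q a b c = Q a c b.
  by apply: eq_bigr => q _; congr (_ * _); exact: christoffel_sym.
have cE a b c : curvature g a b c y 0 l = D a b c + Q a b c - (D b a c + Q b a c).
  exact: curvatureE.
move: D Q DS QS cE => D Q DS QS cE.
rewrite !cE (DS i j k) (DS j k i) (DS k i j) (QS i j k) (QS j k i) (QS k i j); ring.
Qed.

Hypothesis killX : \forall z \near y, forall i j,
  nabla_lower g X i j z + nabla_lower g X j i z = 0.

Lemma nabla_lower_skew i j : nabla_lower g X j i y = - nabla_lower g X i j y.
Proof. by apply/eqP; rewrite -addr_eq0 (nbhs_singleton killX). Qed.

Lemma nabla2_lower_skew k i j : nabla2_lower k j i = - nabla2_lower k i j.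
Proof.
rewrite /nabla2_lower.
have -> : 'D_(delta_mx 0 k) (nabla_lower g X j i) y =
    - 'D_(delta_mx 0 k) (nabla_lower g X i j) y.
  rewrite -derive_opp; last exact: differentiable_nabla_lower.
  apply: near_eq_derive; apply: filterS killX => z kz.
  by apply/eqP; rewrite -addr_eq0 kz.
have S a b : \sum_l christoffel g y k a l * nabla_lower g X l b y =
  - \sum_l christoffel g y k a l * nabla_lower g X b l y.
  by rewrite -sumrN; apply: eq_bigr => l _; rewrite nabla_lower_skew mulrN.
rewrite (S j i) (S i j); move: ('D__ _ _) (\sum__ _) (\sum__ _) => *; ring.
Qed.

(* Skewness of nabla_i X_j together with the Ricci identity determines all
   second covariant derivatives, as the metricity and torsion equations do for
   the Christoffel symbols; the first Bianchi identity collapses the result. *)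
Lemma killing_nabla2_lower k i j :
  nabla2_lower k i j = \sum_l lower g X l y * curvature g i j k y 0 l.
Proof.
pose rho a b c := \sum_l lower g X l y * curvature g a b c y 0 l.
have ric a b c : nabla2_lower a b c - nabla2_lower b a c = - rho a b c.
  by exact: ricci_lower.
have bia : rho i j k + rho j k i + rho k i j = 0.
  rewrite -!big_split /= big1 // => l _.
  by rewrite -!mulrDr bianchi mulr0.
(* Write N for [nabla2_lower]. By skewness the three cyclic identities evaluate N(k,i,j) + N(i,j,k),
   N(i,j,k) + N(j,k,i) and N(j,k,i) + N(k,i,j). The first plus the third minus the second is 2
   N(k,i,j), and Bianchi turns its value into 2 [rho i j k]. *)
have := ric k i j; have := ric i j k; have := ric j k i.
rewrite (nabla2_lower_skew i k j) (nabla2_lower_skew j i k) (nabla2_lower_skew k i j).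
rewrite -/(rho i j k); move: (nabla2_lower _ _ _) => a.
move: (nabla2_lower _ _ _) (nabla2_lower _ _ _).
move: bia; move: (rho _ _ _) (rho _ _ _) (rho _ _ _) => *.
lra.
Qed.

End Curvature.

(** * Metric connections and divergence *)

Section MatrixDerivative.
Context {R : realType} {V : normedModType R}.

Definition mxderive p q (v : V) (A : V -> 'M[R]_(p, q)) (x : V) : 'M[R]_(p, q) :=
  \matrix_(i, j) 'D_v (fun z => A z i j) x.

Definition mxdifferentiable p q (A : V -> 'M[R]_(p, q)) (x : V) :=
  forall i j, differentiable (fun z => A z i j) x.

Lemma mxdifferentiableM p q r (A : V -> 'M[R]_(p, q)) (B : V -> 'M[R]_(q, r)) x :
  mxdifferentiable A x -> mxdifferentiable B x ->
  mxdifferentiable (fun z => A z *m B z) x.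
Proof.
move=> dA dB i j; under eq_fun do rewrite mxE.
by apply: differentiable_bigsum => k; exact: differentiableM.
Qed.

Lemma mxderiveM p q r (A : V -> 'M[R]_(p, q)) (B : V -> 'M[R]_(q, r)) x v :
  mxdifferentiable A x -> mxdifferentiable B x ->
  mxderive v (fun z => A z *m B z) x =
  mxderive v A x *m B x + A x *m mxderive v B x.
Proof.
move=> dA dB; apply/matrixP => i j; rewrite !mxE.
under eq_fun do rewrite mxE.
rewrite derive_bigsum => [|k]; last exact: differentiableM.
rewrite -big_split /=; apply: eq_bigr => k _.
by rewrite derive_mul // !mxE.
Qed.

Lemma mxdifferentiable_tr p q (A : V -> 'M[R]_(p, q)) x :
  mxdifferentiable A x -> mxdifferentiable (fun z => (A z)^T) x.
Proof. by move=> dA i j; under eq_fun do rewrite mxE. Qed.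

Lemma mxderive_tr p q (A : V -> 'M[R]_(p, q)) x v :
  mxderive v (fun z => (A z)^T) x = (mxderive v A x)^T.
Proof. by apply/matrixP => i j; rewrite !mxE; under eq_fun do rewrite mxE. Qed.

End MatrixDerivative.

Section Connection.
Context {R : realType} {n : nat}.
Variable g : 'rV[R]_n -> 'M[R]_n.
Implicit Types (x v : 'rV[R]_n).

(** The connection one-form evaluated at [v]; it acts from the right because vectors are rows. *)
Definition connection_mx x v : 'M[R]_n :=
  \matrix_(j, k) \sum_i christoffel g x i j k * v 0 i.

Lemma connection_mx_apply x v (w : 'rV[R]_n) k :
  (w *m connection_mx x v) 0 k =
  \sum_i \sum_j christoffel g x i j k * v 0 i * w 0 j.
Proof.
rewrite mxE exchange_big /=; apply: eq_bigr => j _; rewrite mxE mulrC mulr_suml.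
by [].
Qed.

Lemma nablaE v (W : 'rV[R]_n -> 'rV[R]_n) x :
  nabla g v W x = mxderive v W x + W x *m connection_mx x v.
Proof. by apply/rowP => k; rewrite [RHS]mxE connection_mx_apply !mxE. Qed.

Variable x : 'rV[R]_n.
Hypothesis gu : g x \in unitmx.
Hypothesis gs : \forall z \near x, (g z)^T = g z.
Hypothesis dg : mxdifferentiable g x.

Let dsym i j k : 'D_(delta_mx 0 k) (fun z => g z i j) x =
  'D_(delta_mx 0 k) (fun z => g z j i) x.
Proof.
by apply: near_eq_derive; apply: filterS gs => z gz; rewrite -[in LHS]gz mxE.
Qed.

Lemma christoffel_lower i j p : \sum_k christoffel g x i j k * g x k p =
  2^-1 * ('D_(delta_mx 0 i) (fun z => g z j p) x
     + 'D_(delta_mx 0 j) (fun z => g z i p) x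
     - 'D_(delta_mx 0 p) (fun z => g z i j) x).
Proof.
pose F l := 2^-1 * ('D_(delta_mx 0 i) (fun z => g z j l) x
     + 'D_(delta_mx 0 j) (fun z => g z i l) x
     - 'D_(delta_mx 0 l) (fun z => g z i j) x).
have -> : \sum_k christoffel g x i j k * g x k p =
    \sum_l F l * \sum_k (g x p k * invmx (g x) k l).
  under [RHS]eq_bigr do rewrite mulr_sumr.
  rewrite exchange_big /=; apply: eq_bigr => k _.
  rewrite /christoffel mulr_sumr mulr_suml; apply: eq_bigr => l _.
  have -> : g x k p = g x p k by rewrite -[in LHS](nbhs_singleton gs) mxE.
  rewrite /F; ring.
rewrite (bigD1 p) //= [X in _ + X]big1 ?addr0.
  have := congr1 (fun A : 'M[R]_n => A p p) (mulmxV gu).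
  by rewrite !mxE eqxx => ->; rewrite mulr1.
move=> l /negbTE lp; have := congr1 (fun A : 'M[R]_n => A p l) (mulmxV gu).
by rewrite !mxE eq_sym lp => ->; rewrite mulr0.
Qed.

(** Metric compatibility: in the sum of the first-kind Christoffel symbols (k, i; j) and (k, j; i),
    the derivatives in the directions i and j cancel. *)
Lemma mxderive_metric v : mxderive v g x =
  connection_mx x v *m g x + g x *m (connection_mx x v)^T.
Proof.
apply/matrixP => i j; rewrite !mxE (derive_row_expand v (dg i j)).
have L a b : \sum_l connection_mx x v a l * g x l b =
    \sum_k v 0 k * \sum_l christoffel g x k a l * g x l b.
  under eq_bigr do rewrite mxE mulr_suml.
  under [RHS]eq_bigr do rewrite mulr_sumr.
  rewrite exchange_big /=; apply: eq_bigr => k _; apply: eq_bigr => l _; ring.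
have -> : \sum_l g x i l * (connection_mx x v)^T l j =
    \sum_l connection_mx x v j l * g x l i.
  apply: eq_bigr => l _; rewrite mxE mulrC; congr (_ * _).
  by rewrite -[in LHS](nbhs_singleton gs) mxE.
rewrite !L -big_split /=; apply: eq_bigr => k _.
rewrite !christoffel_lower -mulrDr; congr (_ * _).
by rewrite (dsym j i) (dsym k j) (dsym k i); field.
Qed.

(** Differentiate the constant inner product, using metric compatibility. For an orthonormal frame
    this puts the connection coefficients into so(n). *)
Lemma inner_nabla_skew (E F : 'rV[R]_n -> 'rV[R]_n) (c : R) v :
  mxdifferentiable E x -> mxdifferentiable F x ->
  (\forall z \near x, inner g z (E z) (F z) = c) ->
  inner g x (nabla g v E x) (F x) = - inner g x (nabla g v F x) (E x).
Proof.
move=> dE dF EF; apply/eqP; rewrite -addr_eq0; apply/eqP.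
have : mxderive v (fun z => E z *m g z *m (F z)^T) x = 0.
  apply/matrixP => i j; rewrite !ord1 !mxE.
  rewrite (@near_eq_derive _ _ _ _ (fun=> c)) ?derive_cst //.
rewrite mxderiveM; [|exact: mxdifferentiableM|exact: mxdifferentiable_tr].
rewrite mxderiveM // mxderive_tr mxderive_metric => D.
have -> : inner g x (nabla g v F x) (E x) = (E x *m g x *m (nabla g v F x)^T) 0 0.
  rewrite /inner; set A := nabla g v F x *m _ *m _.
  have -> : A 0 0 = A^T 0 0 by rewrite [RHS]mxE.
  by rewrite /A !trmx_mul trmxK mulmxA (nbhs_singleton gs).
rewrite /inner; set A := _ *m _ *m _; set B := _ *m _ *m _.
have -> : A 0 0 + B 0 0 = (A + B) 0 0 by rewrite [RHS]mxE.
suff -> : A + B = 0 by rewrite mxE.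
rewrite -D /A /B !nablaE !linearD /= trmx_mul !(mulmxDl, mulmxDr) !mulmxA.
by rewrite !addrA [LHS]addrAC.
Qed.

End Connection.

Section Divergence.
Context {R : realType} {m : nat}.
Variables (h : 'rV[R]_m -> 'M[R]_m) (x : 'rV[R]_m).
Implicit Types (J : 'rV[R]_m -> 'rV[R]_m -> R[i]).

(** With the e_a as rows of [P], orthonormality says that [h x *m P^T] is a right inverse of [P];
    being square, it is also a left inverse. The basis thus disappears from the divergence, which
    becomes a contraction with the inverse Gram matrix. *)
Lemma orthonormal_basis_sum (e : 'I_m -> 'rV[R]_m) i j :
  orthonormal_basis h x e -> \sum_a e a 0 i * e a 0 j = invmx (h x) i j.
Proof.
move=> on; pose P := \matrix_a e a.
have PhP : P *m (h x *m P^T) = 1%:M.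
  apply/matrixP => a b; rewrite mulmxA [RHS]mxE -on /inner.
  rewrite !mxE; apply: eq_bigr => k _; rewrite !mxE; congr (_ * _).
  by apply: eq_bigr => l _; rewrite !mxE.
have hPP : h x *m (P^T *m P) = 1%:M by rewrite mulmxA; exact: mulmx1C.
have [hu _] := mulmx1_unit hPP.
have <- : P^T *m P = invmx (h x) by rewrite -[LHS](mulKmx hu) hPP mulmx1.
by rewrite mxE; apply: eq_bigr => a _; rewrite !mxE.
Qed.

Lemma divergence_basis (e f : 'I_m -> 'rV[R]_m) J :
  orthonormal_basis h x e -> orthonormal_basis h x f ->
  divergence h e J x = divergence h f J x.
Proof.
have E (e' : 'I_m -> 'rV[R]_m) : orthonormal_basis h x e' ->
    divergence h e' J x =
    \sum_i \sum_j (invmx (h x) i j)%:C * nabla_form h J i j x.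
  move=> on; rewrite /divergence exchange_big; apply: eq_bigr => i _.
  rewrite exchange_big; apply: eq_bigr => j _; rewrite -mulr_suml; congr (_ * _).
  by rewrite -(orthonormal_basis_sum i j on) rmorph_sum.
by move=> one onf; rewrite !E.
Qed.

(** The Leibniz rule for the pairing of a one-form with a vector field. Linearity of [J] is asked
    only near [x]: the current contains directional derivatives of the map, which are linear in the
    direction where the map is differentiable. *)
Lemma nabla_form_diag J (E : 'rV[R]_m -> 'rV[R]_m) :
  (\forall z \near x, forall Y, J z Y = \sum_l (Y 0 l)%:C * J z (delta_mx 0 l)) ->
  (forall l, cdifferentiable (fun z => J z (delta_mx 0 l)) x) ->
  (forall l, differentiable (fun z => E z 0 l) x) ->
  \sum_i \sum_j (E x 0 i * E x 0 j)%:C * nabla_form h J i j x =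
  cderive (E x) (fun z => J z (E z)) x - J x (nabla h (E x) E x).
Proof.
move=> linJ dJ dE.
have dEC l : cdifferentiable (fun z => (E z 0 l)%:C) x by exact: cdifferentiable_real.
rewrite (@near_eq_cderive _ _ _
  (fun z => \sum_l (E z 0 l)%:C * J z (delta_mx 0 l))); last first.
  by apply: filterS linJ => z; apply.
rewrite cderive_sum; last by move=> l; exact: cdifferentiableM.
rewrite [J x (nabla _ _ _ _)](nbhs_singleton linJ) -sumrB exchange_big /=.
(* The derivatives of the components of [E] occur in both terms on the right and cancel here. *)
under [RHS]eq_bigr => l _ do rewrite cderiveM // cderive_real mxE rmorphD /= mulrDl opprD
  [X in X + _]addrC addrA addrK.
rewrite sumrB.
under [in RHS]eq_bigr => l _ do rewrite cderive_expand // mulr_sumr.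
have -> : \sum_k (\sum_i \sum_j christoffel h x i j k * E x 0 i * E x 0 j)%:C
      * J x (delta_mx 0 k) =
    \sum_j \sum_i \sum_k (christoffel h x i j k * E x 0 i * E x 0 j)%:C
      * J x (delta_mx 0 k).
  under eq_bigr => k _ do (rewrite exchange_big rmorph_sum mulr_suml;
    under eq_bigr => j _ do rewrite rmorph_sum mulr_suml).
  rewrite exchange_big; apply: eq_bigr => j _; exact: exchange_big.
rewrite -sumrB; apply: eq_bigr => j _; rewrite -sumrB; apply: eq_bigr => i _.
rewrite /nabla_form mulrBr mulr_sumr; congr (_ - _).
  by rewrite rmorphM /=; ring.
by apply: eq_bigr => k _; rewrite !rmorphM /=; ring.
Qed.

End Divergence.

(** * Spinor algebra *)

Section Adjoint.
Context {R : realType}.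

Definition adjmx p q (A : 'M[R[i]]_(p, q)) : 'M[R[i]]_(q, p) := (map_mx conjc A)^T.

Definition realmx p q (A : 'M[R]_(p, q)) : 'M[R[i]]_(p, q) :=
  map_mx (real_complex R) A.

Lemma realmxM p q r (A : 'M[R]_(p, q)) (B : 'M[R]_(q, r)) :
  realmx (A *m B) = realmx A *m realmx B.
Proof. exact: map_mxM. Qed.

Lemma realmxB p q (A B : 'M[R]_(p, q)) : realmx (A - B) = realmx A - realmx B.
Proof. exact: map_mxB. Qed.

Lemma realmx_tr p q (A : 'M[R]_(p, q)) : realmx A^T = (realmx A)^T.
Proof. by apply/matrixP => i j; rewrite !mxE. Qed.

Lemma adjmxM p q r (A : 'M[R[i]]_(p, q)) (B : 'M[R[i]]_(q, r)) :
  adjmx (A *m B) = adjmx B *m adjmx A.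
Proof. by rewrite /adjmx map_mxM trmx_mul. Qed.

Lemma adjmxD p q (A B : 'M[R[i]]_(p, q)) : adjmx (A + B) = adjmx A + adjmx B.
Proof. by rewrite /adjmx map_mxD linearD. Qed.

Lemma adjmxN p q (A : 'M[R[i]]_(p, q)) : adjmx (- A) = - adjmx A.
Proof. by rewrite /adjmx map_mxN linearN. Qed.

Lemma adjmx0 p q : adjmx (0 : 'M[R[i]]_(p, q)) = 0.
Proof. by rewrite /adjmx map_mx0 trmx0. Qed.

Lemma adjmx_sum p q (I : finType) (F : I -> 'M[R[i]]_(p, q)) :
  adjmx (\sum_i F i) = \sum_i adjmx (F i).
Proof. by apply: (big_morph _ (@adjmxD p q) (adjmx0 p q)). Qed.

Lemma adjmxZ_real p q (c : R) (A : 'M[R[i]]_(p, q)) :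
  adjmx (c%:C *: A) = c%:C *: adjmx A.
Proof. by apply/matrixP => i j; rewrite !mxE rmorphM /= oppr0. Qed.

Lemma adjmx_real p q (A : 'M[R]_(p, q)) : adjmx (realmx A) = realmx A^T.
Proof. by apply/matrixP => i j; rewrite !mxE /= oppr0. Qed.

Lemma hdotE d (u v : 'cV[R[i]]_d) : hdot u v = (adjmx u *m v) 0 0.
Proof. by rewrite mxE; apply: eq_bigr => k _; rewrite !mxE. Qed.

(** All pairings of the components of a vector spinor become the entries of one matrix, so that
    contractions with a tensor of the target become traces. *)
Lemma hdot_col d n (P : 'M[R[i]]_(d, n)) (C : 'M[R[i]]_d) i j :
  hdot (col i P) (C *m col j P) = (adjmx P *m C *m P) i j.
Proof.
rewrite -mulmxA [RHS]mxE /hdot; apply: eq_bigr => k _; rewrite !mxE.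
by congr (_ * _); apply: eq_bigr => l _; rewrite !mxE.
Qed.

Lemma adjmx_gamma m (G : spinor_module R m) a : adjmx (G a) = - G a.
Proof.
have E : forall u v, hdot u ((G a + adjmx (G a)) *m v) = 0.
  move=> u v; rewrite mulmxDl.
  have -> : hdot u (G a *m v + adjmx (G a) *m v) =
      hdot u (G a *m v) + hdot u (adjmx (G a) *m v).
    by rewrite !hdotE mulmxDr mxE.
  by rewrite gamma_skew !hdotE adjmxM -mulmxA addNr.
apply/eqP; rewrite -addr_eq0 addrC; apply/eqP/matrixP => i j; rewrite [RHS]mxE.
have := E (delta_mx i 0) (delta_mx j 0); rewrite -colE /hdot (bigD1 i) //= big1.
  by rewrite addr0 [col _ _ _ _]mxE [delta_mx _ _ _ _]mxE !eqxx rmorph1 mul1r.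
by move=> k /negbTE ki; rewrite [delta_mx _ _ _ _]mxE ki rmorph0 mul0r.
Qed.

End Adjoint.

Section ComplexMatrixDerivative.
Context {R : realType} {m : nat}.
Implicit Types (x v : 'rV[R]_m).

Definition cmxderive p q v (A : 'rV[R]_m -> 'M[R[i]]_(p, q)) x : 'M[R[i]]_(p, q) :=
  \matrix_(i, j) cderive v (fun z => A z i j) x.

Definition cmxdifferentiable p q (A : 'rV[R]_m -> 'M[R[i]]_(p, q)) x :=
  forall i j, cdifferentiable (fun z => A z i j) x.

Lemma cmxdifferentiable_cst p q (A : 'M[R[i]]_(p, q)) x :
  cmxdifferentiable (fun=> A) x.
Proof. by move=> i j; exact: cdifferentiable_cst. Qed.

Lemma cmxdifferentiableM p q r (A : 'rV[R]_m -> 'M[R[i]]_(p, q))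
    (B : 'rV[R]_m -> 'M[R[i]]_(q, r)) x :
  cmxdifferentiable A x -> cmxdifferentiable B x ->
  cmxdifferentiable (fun z => A z *m B z) x.
Proof.
move=> dA dB i j; under eq_fun do rewrite mxE.
by apply: cdifferentiable_sum => k; exact: cdifferentiableM.
Qed.

Lemma cmxdifferentiable_tr p q (A : 'rV[R]_m -> 'M[R[i]]_(p, q)) x :
  cmxdifferentiable A x -> cmxdifferentiable (fun z => (A z)^T) x.
Proof. by move=> dA i j; under eq_fun do rewrite mxE. Qed.

Lemma cmxdifferentiable_adj p q (A : 'rV[R]_m -> 'M[R[i]]_(p, q)) x :
  cmxdifferentiable A x -> cmxdifferentiable (fun z => adjmx (A z)) x.
Proof.
by move=> dA i j; under eq_fun do rewrite !mxE; exact: cdifferentiable_conj.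
Qed.

Lemma cmxdifferentiable_real p q (A : 'rV[R]_m -> 'M[R]_(p, q)) x :
  mxdifferentiable A x -> cmxdifferentiable (fun z => realmx (A z)) x.
Proof.
by move=> dA i j; under eq_fun do rewrite mxE; exact: cdifferentiable_real.
Qed.

Lemma cmxderive_cst p q (A : 'M[R[i]]_(p, q)) x v : cmxderive v (fun=> A) x = 0.
Proof. by apply/matrixP => i j; rewrite !mxE cderive_cst. Qed.

Lemma cmxderiveM p q r (A : 'rV[R]_m -> 'M[R[i]]_(p, q))
    (B : 'rV[R]_m -> 'M[R[i]]_(q, r)) x v :
  cmxdifferentiable A x -> cmxdifferentiable B x ->
  cmxderive v (fun z => A z *m B z) x =
  cmxderive v A x *m B x + A x *m cmxderive v B x.
Proof.
move=> dA dB; apply/matrixP => i j; rewrite !mxE.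
under eq_fun do rewrite mxE.
rewrite cderive_sum => [|k]; last exact: cdifferentiableM.
rewrite -big_split /=; apply: eq_bigr => k _.
by rewrite cderiveM // !mxE.
Qed.

Lemma cmxderive_tr p q (A : 'rV[R]_m -> 'M[R[i]]_(p, q)) x v :
  cmxderive v (fun z => (A z)^T) x = (cmxderive v A x)^T.
Proof. by apply/matrixP => i j; rewrite !mxE; under eq_fun do rewrite mxE. Qed.

Lemma cmxderive_adj p q (A : 'rV[R]_m -> 'M[R[i]]_(p, q)) x v :
  cmxdifferentiable A x ->
  cmxderive v (fun z => adjmx (A z)) x = adjmx (cmxderive v A x).
Proof.
move=> dA; apply/matrixP => i j; rewrite !mxE.
by under eq_fun do rewrite !mxE; rewrite cderive_conj.
Qed.

Lemma cmxderive_real p q (A : 'rV[R]_m -> 'M[R]_(p, q)) x v :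
  cmxderive v (fun z => realmx (A z)) x = realmx (mxderive v A x).
Proof.
apply/matrixP => i j; rewrite !mxE.
by under eq_fun do rewrite !mxE; rewrite cderive_real.
Qed.

Lemma cderive_trace p (A : 'rV[R]_m -> 'M[R[i]]_p) x v :
  cmxdifferentiable A x ->
  cderive v (fun z => \tr (A z)) x = \tr (cmxderive v A x).
Proof.
by move=> dA; rewrite cderive_sum //; apply: eq_bigr => i _; rewrite mxE.
Qed.

End ComplexMatrixDerivative.

Lemma mxtraceB (R : pzRingType) n (A B : 'M[R]_n) : \tr (A - B) = \tr A - \tr B.
Proof. exact: raddfB. Qed.

Section SpinAlgebra.
Context {R : realType} {m : nat}.
Variable G : spinor_module R m.
Let d := (2 ^ (m %/ 2))%N.

(** For skew [w], the image of an element of so(m) under the spin representation of its Lie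
    algebra. *)
Definition spin_mx (w : 'I_m -> 'I_m -> R) : 'M[R[i]]_d :=
  \sum_a \sum_c (4^-1 * w a c)%:C *: (G a *m G c).

Lemma gamma_swap a b : G a *m G b = - (G b *m G a) + (- 2 * (a == b)%:R)%:M.
Proof. by rewrite -(gamma_clifford G a b) addrC addrK. Qed.

Lemma gamma_commutator a c b :
  G a *m G c *m G b - G b *m (G a *m G c) =
  (2 * (a == b)%:R) *: G c - (2 * (c == b)%:R) *: G a.
Proof.
rewrite -(mulmxA (G a)) (gamma_swap c b) mulmxDr mulmxN (mulmxA (G a)).
rewrite (gamma_swap a b) mulmxDl mulNmx opprD opprK mul_mx_scalar mul_scalar_mx.
rewrite -mulmxA -(addrA (_ *m _)) [_ *m _ + _]addrC addrK.
by rewrite !mulNr !scaleNr opprK.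
Qed.

(** Clifford multiplication is parallel, in infinitesimal form. Only the terms with a = b or c = b
    survive; by skewness of [w] both contribute the same, each with a factor 2, which the 4^-1 in
    [spin_mx] compensates. *)
Lemma spin_mx_commutator w b : (forall a c, w a c = - w c a) ->
  spin_mx w *m G b - G b *m spin_mx w = \sum_c (w b c)%:C *: G c.
Proof.
move=> skew; rewrite /spin_mx mulmx_suml mulmx_sumr -sumrB.
transitivity (\sum_a \sum_c (4^-1 * w a c)%:C *:
   ((2 * (a == b)%:R) *: G c - (2 * (c == b)%:R) *: G a)).
  apply: eq_bigr => a _; rewrite mulmx_suml mulmx_sumr -sumrB.
  apply: eq_bigr => c _; rewrite -gamma_commutator scalerBr.
  by rewrite -scalemxAl -scalemxAr.
under eq_bigr => a _.
  under eq_bigr => c _ do rewrite scalerBr !scalerA.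
  rewrite sumrB; over.
rewrite sumrB [X in _ - X]exchange_big /=.
rewrite (bigD1 b) //= [X in _ + X - _]big1 ?addr0; last first.
  move=> a /negbTE ab; apply: big1 => c _.
  by rewrite ab !mulr0 scale0r.
rewrite [X in _ - X](bigD1 b) //= [X in _ - (_ + X)]big1 ?addr0; last first.
  move=> a /negbTE ab; apply: big1 => c _.
  by rewrite ab !mulr0 scale0r.
rewrite -sumrB; apply: eq_bigr => c _; rewrite eqxx -scalerBl; congr (_ *: _).
rewrite (skew c b) !mulr1 -mulrBl -rmorphB /=.
rewrite -[2]/((1 + 1)%:R) -(rmorph_nat (real_complex R)) -rmorphM.
by congr _%:C; field.
Qed.

(** The adjoint reverses [G a *m G c]; renaming the indices moves the reversal to [w], at the cost
    of a sign. This is the metricity of the spin connection. *)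
Lemma adjmx_spin_mx w : (forall a c, w a c = - w c a) ->
  adjmx (spin_mx w) = - spin_mx w.
Proof.
move=> skew; rewrite /spin_mx adjmx_sum.
under eq_bigr => a _ do rewrite adjmx_sum.
rewrite exchange_big -sumrN; apply: eq_bigr => a _; rewrite -sumrN.
apply: eq_bigr => c _; rewrite adjmxZ_real adjmxM !adjmx_gamma mulNmx mulmxN opprK.
rewrite (skew c a) mulrN rmorphN; exact: scaleNr.
Qed.

(* Differentiating the bilinear [\tr (P^* G_a P A^T)] along a frame: the Dirac
   equation removes the terms in [D a], the spin connection only produces the
   divergence of the frame, and the connection of the target turns the
   derivative of [A] into a covariant one. *)
Lemma dirac_current_divergence n (P : 'M[R[i]]_(d, n)) (D : 'I_m -> 'M[R[i]]_(d, n))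
    (w : 'I_m -> 'I_m -> 'I_m -> R) (K : 'I_m -> 'M[R]_n)
    (A : 'M[R]_n) (dA : 'I_m -> 'M[R]_n) (dP : 'I_m -> 'M[R[i]]_(d, n)) :
  (forall a b c, w a b c = - w a c b) ->
  (forall a, dP a = D a - spin_mx (w a) *m P - P *m realmx (K a)) ->
  \sum_a G a *m D a = 0 ->
  \sum_a (\tr (adjmx (dP a) *m G a *m P *m (realmx A)^T) +
          \tr (adjmx P *m G a *m dP a *m (realmx A)^T) +
          \tr (adjmx P *m G a *m P *m (realmx (dA a))^T)
   - \sum_c (w a a c)%:C * \tr (adjmx P *m G c *m P *m (realmx A)^T)) =
  \sum_a \tr (adjmx P *m G a *m P *m (realmx (dA a - K a *m A - A *m (K a)^T))^T).
Proof.
move=> skew dPE dirac.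
have dirac' : \sum_a adjmx (D a) *m G a = 0.
  have := congr1 (@adjmx _ _ _) dirac; rewrite adjmx_sum adjmx0 => E.
  rewrite -[RHS]oppr0 -[X in - X]E -sumrN; apply: eq_bigr => a _.
  by rewrite adjmxM adjmx_gamma mulmxN opprK.
have T1 : \sum_a \tr (adjmx (D a) *m G a *m P *m (realmx A)^T) = 0.
  by rewrite -linear_sum -!mulmx_suml dirac' !mul0mx linear0.
have T2 : \sum_a \tr (adjmx P *m G a *m D a *m (realmx A)^T) = 0.
  under eq_bigr => a _ do rewrite -(mulmxA (adjmx P)).
  by rewrite -linear_sum -mulmx_suml -mulmx_sumr dirac mulmx0 mul0mx linear0.
(* The traces containing [D a] vanish only after summation over a; adding them on the right permits
   a comparison term by term. *)
rewrite -[RHS]addr0 -[X in _ = _ + X]T1 -[RHS]addr0 -[X in _ = _ + X]T2 -!big_split /=.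
apply: eq_bigr => a _.
set O := spin_mx (w a); set At := (realmx A)^T; set k := realmx (K a).
have S : \sum_c (w a a c)%:C * \tr (adjmx P *m G c *m P *m At) =
   \tr (adjmx P *m (O *m G a - G a *m O) *m P *m At).
  rewrite (spin_mx_commutator a (skew a)) mulmx_sumr !mulmx_suml linear_sum.
  by apply: eq_bigr => c _; rewrite -scalemxAr -!scalemxAl linearZ.
have e1 : \tr (adjmx (dP a) *m G a *m P *m At) =
    \tr (adjmx (D a) *m G a *m P *m At) + \tr (adjmx P *m O *m G a *m P *m At)
    - \tr (adjmx P *m G a *m P *m (At *m realmx (K a)^T)).
  have -> : adjmx (dP a) = adjmx (D a) + adjmx P *m O - realmx (K a)^T *m adjmx P.
    rewrite dPE !adjmxD !adjmxN !adjmxM (adjmx_spin_mx (skew a)) adjmx_real.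
    by rewrite mulmxN opprK.
  (* Cyclicity brings the connection matrix from the left end, where the adjoint put it, next to
     [At]. *)
  rewrite (mxtrace_mulC _ (At *m _)) -(mulmxA At) (mxtrace_mulC At) !mulmxA.
  by rewrite 3!mulmxBl 3!mulmxDl mxtraceB mxtraceD.
have e2 : \tr (adjmx P *m G a *m dP a *m At) =
    \tr (adjmx P *m G a *m D a *m At) - \tr (adjmx P *m G a *m O *m P *m At)
    - \tr (adjmx P *m G a *m P *m (k *m At)).
  by rewrite dPE 2!mulmxBr 2!mulmxBl 2!mxtraceB !mulmxA.
have e3 : \tr (adjmx P *m (O *m G a - G a *m O) *m P *m At) =
    \tr (adjmx P *m O *m G a *m P *m At) - \tr (adjmx P *m G a *m O *m P *m At).
  by rewrite mulmxBr 2!mulmxBl mxtraceB !mulmxA.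
have e4 : \tr (adjmx P *m G a *m P *m (realmx (dA a - K a *m A - A *m (K a)^T))^T) =
    \tr (adjmx P *m G a *m P *m (realmx (dA a))^T)
    - \tr (adjmx P *m G a *m P *m (At *m realmx (K a)^T))
    - \tr (adjmx P *m G a *m P *m (k *m At)).
  have -> : (realmx (dA a - K a *m A - A *m (K a)^T))^T =
      (realmx (dA a))^T - At *m realmx (K a)^T - k *m At.
    by rewrite !realmxB !realmxM 2!linearB /= !trmx_mul !realmx_tr trmxK.
  move: (adjmx P *m G a *m P) (_^T) (At *m _) (k *m At) => Z B1 B2 B3.
  by rewrite 2!mulmxBr 2!mxtraceB.
(* Here p and r are the traces with the spin connection before and after [G a], which the commutator
   removes, while q and t are those with the connection of the target. *)
have id_traces (X1 X2 X3 S0 S1 Y4 Y1 Y2 p q r t : R[i]) :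
    S0 = S1 -> X1 = Y1 + p - q -> X2 = Y2 - r - t -> S1 = p - r ->
    Y4 = X3 - q - t -> X1 + X2 + X3 - S0 = Y4 + Y1 + Y2.
  by move=> -> -> -> -> ->; ring.
exact: id_traces S e1 e2 e3 e4.
Qed.

End SpinAlgebra.

(** * Charts *)

(** Within the open coordinate image of the chart, the image of [U] is its preimage under the
    continuous [param a]. *)
Lemma coord_image_open (R : realType) m (M : manifold R m) (a : chart M) (U : set M) :
  open U -> U `<=` dom a -> open (coord a @` U).
Proof.
move=> oU Ua; have oD := @coord_open _ _ M a.
have := @param_continuous _ _ M a; rewrite continuous_open_subspace // => pc.
rewrite openE => _ [p Up <-].
have Dp : (coord a @` dom a) (coord a p) by exists p => //; exact: Ua.
have nU : nbhs (coord a p) (param a @^-1` U).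
  apply: pc; first by rewrite inE.
  by rewrite coordK; [exact: open_nbhs_nbhs|exact: Ua].
have nD : nbhs (coord a p) (coord a @` dom a) by exact: open_nbhs_nbhs.
apply: filterS2 nU nD => z /= Uz [q Dq qz]; exists q => //.
by move: Uz; rewrite -qz coordK.
Qed.

Lemma local_dom_open (R : realType) m n (M : manifold R m) (N : manifold R n)
    (h : metric M) (G : spinor_module R m) (S : spin_structure h G)
    (phi : M -> N) (s : triv S) (b : chart N) :
  continuous phi -> open (local_dom phi s b).
Proof.
move=> cphi; apply: coord_image_open => [|p [sp _]]; last exact: triv_sub.
apply: openI; first exact: triv_open.
by apply: open_comp => [p _|]; [exact: cphi|exact: dom_open].
Qed.

Lemma posdef_unitmx (R : realType) n (A : 'M[R]_n) :
  (forall v : 'rV[R]_n, v != 0 -> 0 < (v *m A *m v^T) 0 0) -> A \in unitmx.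
Proof.
move=> pos; rewrite -row_free_unit; apply: inj_row_free => v vA.
apply/eqP; apply: contraT => /pos; rewrite vA mul0mx mxE ltxx.
by [].
Qed.

Section MetricInChart.
Context {R : realType} {n : nat} {N : manifold R n}.
Variables (g : metric N) (b : chart N) (y : 'rV[R]_n).
Hypothesis Dy : (coord b @` dom b) y.

Let nearD : \forall z \near y, (coord b @` dom b) z.
Proof. exact: open_nbhs_nbhs (conj (@coord_open _ _ N b) Dy). Qed.

Lemma gram_near_sym : \forall z \near y, (g b z)^T = g b z.
Proof. by apply: filterS nearD => _ [p Dp <-]; exact: gram_sym. Qed.

Lemma gram_near_unit : \forall z \near y, g b z \in unitmx.
Proof.
apply: filterS nearD => _ [p Dp <-]; apply: posdef_unitmx; exact: gram_pos.
Qed.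

Lemma gram_twice_differentiable i j :
  twice_differentiable (fun z => g b z i j) y.
Proof.
exact (smooth_on_twice_differentiable (@coord_open _ _ N b) Dy
  (@gram_smooth _ _ _ g b i j)).
Qed.

Lemma vector_field_twice_differentiable (X : vector_field N) k :
  twice_differentiable (fun z => X b z 0 k) y.
Proof.
exact (smooth_on_twice_differentiable (@coord_open _ _ N b) Dy
  (@vf_smooth _ _ _ X b k)).
Qed.

Lemma killing_near (X : vector_field N) : killing g X ->
  \forall z \near y, forall i j,
    nabla_lower (g b) (X b) i j z + nabla_lower (g b) (X b) j i z = 0.
Proof. by move=> kX; apply: filterS nearD => _ [p Dp <-]; exact: kX. Qed.

End MetricInChart.

Lemma smooth_on_sub (R : realType) m (U V : set 'rV[R]_m) f :
  U `<=` V -> smooth_on V f -> smooth_on U f.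
Proof.
move=> UV sf k; suff CUV : forall f', C_ k V f' -> C_ k U f' by exact: CUV.
elim: k => [|k IH] f' /=; first by move=> cf x /UV; exact: cf.
by move=> [df cf]; split=> [x /UV|i]; [exact: df|exact: IH].
Qed.

(** * The one-form dual to a Killing field, along a map *)

Lemma inner_lower (R : realType) n (g : 'rV[R]_n -> 'M[R]_n) (X : 'rV[R]_n -> 'rV[R]_n)
    y (V : 'rV[R]_n) : inner g y V (X y) = \sum_k lower g X k y * V 0 k.
Proof.
rewrite /inner -mulmxA mxE; apply: eq_bigr => k _; rewrite mulrC; congr (_ * _).
by rewrite mxE; apply: eq_bigr => j _; rewrite mxE.
Qed.

Lemma inner_expand (R : realType) n (g : 'rV[R]_n -> 'M[R]_n) y (V W : 'rV[R]_n) :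
  inner g y V W = \sum_l V 0 l * inner g y (delta_mx 0 l) W.
Proof.
rewrite /inner -mulmxA mxE; apply: eq_bigr => l _; congr (_ * _).
by rewrite -mulmxA -rowE [RHS]mxE.
Qed.

Lemma skew_quadratic_form (R : realType) n (A : 'I_n -> 'I_n -> R) (w : 'I_n -> R) :
  (forall i j, A j i = - A i j) -> \sum_k \sum_l w l * A l k * w k = 0.
Proof.
move=> skew; set q := LHS; suff : q = - q by lra.
rewrite /q {1}exchange_big /= -sumrN; apply: eq_bigr => k _.
rewrite -sumrN; apply: eq_bigr => l _; rewrite (skew l k); ring.
Qed.

Section TargetTerms.
Context {R : realType} {n : nat}.
Variables (g : 'rV[R]_n -> 'M[R]_n) (X : 'rV[R]_n -> 'rV[R]_n).
Context {V : normedModType R}.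
Variables (F : V -> 'rV[R]_n) (x : V).
Let y := F x.
Hypothesis gu : \forall z \near y, g z \in unitmx.
Hypothesis gs : \forall z \near y, (g z)^T = g z.
Hypothesis dg : forall i j, twice_differentiable (fun z => g z i j) y.
Hypothesis dX : forall k, twice_differentiable (fun z => X z 0 k) y.
Hypothesis killX : \forall z \near y, forall i j,
  nabla_lower g X i j z + nabla_lower g X j i z = 0.
Hypothesis dF : forall k, differentiable (fun z => F z 0 k) x.

Lemma differentiable_lower_comp k : differentiable (fun z => lower g X k (F z)) x.
Proof.
apply: differentiable_comp_row => //.
exact: twice_differentiableW (twice_differentiable_lower dg dX k).
Qed.

(** By the chain rule the derivative of X_k along the map is W^l nabla_l X_k plus a Christoffel
    term. Since [W x] is also the direction of differentiation, the first part is a skew form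
    evaluated on (W, W) and vanishes; the Christoffel term completes the derivative of [W] to a
    covariant one. *)
Lemma derive_lower_pairing (W : V -> 'rV[R]_n) (v : V) :
  mxdifferentiable W x ->
  W x = \row_k 'D_v (fun z => F z 0 k) x ->
  'D_v (fun z => \sum_k lower g X k (F z) * W z 0 k) x =
  \sum_k lower g X k y * ('D_v (fun z => W z 0 k) x +
     \sum_i \sum_j christoffel g y i j k * W x 0 i * W x 0 j).
Proof.
move=> dW Wx.
have dL := differentiable_lower_comp.
have dLW k : differentiable (fun z => lower g X k (F z) * W z 0 k) x.
  by apply: differentiableM.
rewrite derive_bigsum //.
under eq_bigr => k _ do rewrite derive_mul //.
under [RHS]eq_bigr => k _ do rewrite mulrDr.
rewrite !big_split /= addrC; congr (_ + _).
have DL k : 'D_v (fun z => lower g X k (F z)) x =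
    \sum_l W x 0 l * nabla_lower g X l k y
    + \sum_l \sum_p W x 0 l * (christoffel g y l k p * lower g X p y).
  rewrite derive_comp_row //; last first.
    exact: twice_differentiableW (twice_differentiable_lower dg dX k).
  rewrite -big_split /=; apply: eq_bigr => l _; rewrite -mulr_sumr -mulrDr.
  by rewrite /nabla_lower subrK Wx mxE.
under eq_bigr => k _ do rewrite DL mulrDl mulr_suml.
rewrite big_split /= skew_quadratic_form ?add0r; last first.
  by move=> i j; exact: nabla_lower_skew killX i j.
under eq_bigr => k _ do rewrite mulr_suml.
under eq_bigr => k _ do under eq_bigr => l _ do rewrite mulr_suml.
under [RHS]eq_bigr => k _ do rewrite mulr_sumr.
under [RHS]eq_bigr => k _ do under eq_bigr => l _ do rewrite mulr_sumr.
rewrite exchange_big [RHS]exchange_big; apply: eq_bigr => l _.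
rewrite exchange_big; apply: eq_bigr => p _; apply: eq_bigr => k _; ring.
Qed.

Definition nabla_lower_mx (z : V) : 'M[R]_n := \matrix_(i, j) nabla_lower g X i j (F z).

Lemma mxdifferentiable_nabla_lower_mx : mxdifferentiable nabla_lower_mx x.
Proof.
move=> i j; under eq_fun do rewrite mxE.
by apply: differentiable_comp_row => //; exact: differentiable_nabla_lower.
Qed.

(** The chain rule makes the left side w^k nabla_k nabla_i X_j. By [killing_nabla2_lower] the vector
    [w] then passes from the direction of differentiation to the argument of the curvature operator,
    as in the equation for the tension field. *)
Lemma nabla_lower_mx_covariant (v : V) i j :
  let w := \row_k 'D_v (fun z => F z 0 k) x in
  let K := connection_mx g y w in
  (mxderive v nabla_lower_mx x - K *m nabla_lower_mx x
     - nabla_lower_mx x *m K^T) i j =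
  \sum_l lower g X l y * curvature_op g i j y w 0 l.
Proof.
move=> w K.
transitivity (\sum_k w 0 k * nabla2_lower g X y k i j).
  have sub_entry (A B C : 'M[R]_n) : (A - B - C) i j = A i j - B i j - C i j.
    by rewrite 4!mxE.
  rewrite sub_entry [(K *m _) i j]mxE [(_ *m K^T) i j]mxE [mxderive _ _ _ _ _]mxE.
  under eq_fun do rewrite mxE.
  rewrite derive_comp_row //; last exact: differentiable_nabla_lower.
  have -> : \sum_l K i l * nabla_lower_mx x l j =
      \sum_k w 0 k * \sum_l christoffel g y k i l * nabla_lower g X l j y.
    under [RHS]eq_bigr => k _ do rewrite mulr_sumr.
    rewrite exchange_big; apply: eq_bigr => l _; rewrite !mxE mulr_suml.
    by apply: eq_bigr => k _; rewrite mulrA [w 0 k * _]mulrC.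
  have -> : \sum_l nabla_lower_mx x i l * K^T l j =
      \sum_k w 0 k * \sum_l christoffel g y k j l * nabla_lower g X i l y.
    under [RHS]eq_bigr => k _ do rewrite mulr_sumr.
    rewrite exchange_big; apply: eq_bigr => l _; rewrite !mxE mulr_sumr.
    by apply: eq_bigr => k _; rewrite mulrC mulrA [w 0 k * _]mulrC.
  rewrite -!sumrB; apply: eq_bigr => k _.
  by rewrite /w [(\row__ _) 0 k]mxE -!mulrBr.
under eq_bigr => k _ do rewrite (killing_nabla2_lower gu gs dg dX killX) mulr_sumr.
rewrite exchange_big; apply: eq_bigr => l _.
rewrite /curvature_op summxE mulr_sumr; apply: eq_bigr => k _.
have -> : (w 0 k *: curvature g i j k y) 0 l = w 0 k * curvature g i j k y 0 l.
  by rewrite [LHS]mxE.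
exact: mulrCA.
Qed.

End TargetTerms.

(** * The current *)

Lemma mxtrace_realmx_tr (R : realType) n (Z : 'M[R[i]]_n) (A : 'M[R]_n) :
  \tr (Z *m (realmx A)^T) = \sum_i \sum_j Z i j * (A i j)%:C.
Proof.
by apply: eq_bigr => i _; rewrite mxE; apply: eq_bigr => j _; rewrite !mxE.
Qed.

Section Current.
Context {R : realType} {m n : nat}.
Context {M : manifold R m} {N : manifold R n}.
Context {h : metric M} {G : spinor_module R m} {S : spin_structure h G}.
Variables (g : metric N) (phi : M -> N) (psi : vector_spinor S phi).
Variables (X : vector_field N) (s : triv S) (b : chart N).

Local Notation hs := (h (triv_chart s)).
Local Notation F := (local_map phi s b).
Local Notation E := (e_ s).
Local Notation Psi := (psi s b).
Local Notation L k y := (lower (g b) (X b) k y).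
Local Notation AA := (nabla_lower_mx (g b) (X b) F).

Definition spinor_bilinear c z : 'M[R[i]]_n := adjmx (Psi z) *m G c *m Psi z.

Definition spinor_current c z : R[i] :=
  \tr (spinor_bilinear c z *m (realmx (AA z))^T).

Lemma clifford_mul_frame a z : orthonormal_basis hs z (fun a => E a z) ->
  clifford_mul s z (E a z) = G a.
Proof.
move=> on; rewrite /clifford_mul /clifford (bigD1 a) //= big1 ?addr0.
  by rewrite mxE on eqxx scale1r.
by move=> c /negbTE ca; rewrite mxE on eq_sym ca scale0r.
Qed.

Lemma spinor_pairingE z Y i j : spinor_pairing s b psi z Y i j =
  \sum_c (inner hs z Y (E c z))%:C * spinor_bilinear c z i j.
Proof.
rewrite /spinor_pairing hdot_col /clifford_mul /clifford mulmx_sumr mulmx_suml summxE.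
apply: eq_bigr => c _; rewrite -scalemxAr -scalemxAl [LHS]mxE; congr (_ * _).
by rewrite mxE.
Qed.

Lemma spinor_pairing_frame z a i j : orthonormal_basis hs z (fun a => E a z) ->
  spinor_pairing s b psi z (E a z) i j = spinor_bilinear a z i j.
Proof. by move=> on; rewrite /spinor_pairing clifford_mul_frame // hdot_col. Qed.

(** Holds for every [Y], because [clifford_mul] reads [Y] through its products with the frame; it is
    applied to coordinate vectors and to nabla_{e_a} e_a. *)
Lemma currentE z Y : current g s b psi X z Y =
  (2 * \sum_k L k (F z) * dphi phi s b Y z 0 k)%:C
  - \sum_c (inner hs z Y (E c z))%:C * spinor_current c z.
Proof.
rewrite /current inner_lower; congr (_ - _).
under [RHS]eq_bigr => c _ do rewrite /spinor_current mxtrace_realmx_tr mulr_sumr.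
rewrite [RHS]exchange_big; apply: eq_bigr => i _.
under [RHS]eq_bigr => c _ do rewrite mulr_sumr.
rewrite [RHS]exchange_big; apply: eq_bigr => j _.
rewrite spinor_pairingE mulr_suml; apply: eq_bigr => c _.
by rewrite mulrA [nabla_lower_mx _ _ _ _ _ _]mxE.
Qed.

Lemma current_frame z a : orthonormal_basis hs z (fun a => E a z) ->
  current g s b psi X z (E a z) =
  (2 * \sum_k L k (F z) * dphi phi s b (E a z) z 0 k)%:C - spinor_current a z.
Proof.
move=> on; rewrite currentE; congr (_ - _); rewrite (bigD1 a) //= big1 ?addr0.
  by rewrite on eqxx mul1r.
by move=> c /negbTE ca; rewrite on eq_sym ca mul0r.
Qed.

Definition spin_connection z a c d : R :=
  inner hs z (nabla hs (E a z) (E c) z) (E d z).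

Lemma nabla_twistedE z a : nabla_twisted g phi s b (E a z) Psi z =
  cmxderive (E a z) Psi z + spin_mx G (spin_connection z a) *m Psi z
  + Psi z *m realmx (connection_mx (g b) (F z) (dphi phi s b (E a z) z)).
Proof.
rewrite /nabla_twisted; congr (_ + _ + _).
  rewrite /spin_mx mulmx_suml; apply: eq_bigr => c _.
  by rewrite mulmx_suml; apply: eq_bigr => d _; rewrite -scalemxAl.
apply/matrixP => q k; rewrite !mxE exchange_big; apply: eq_bigr => j _.
rewrite !mxE rmorph_sum mulr_sumr; apply: eq_bigr => i _.
by rewrite mulrC.
Qed.

Variable x : 'rV[R]_m.
Hypothesis on : \forall z \near x, orthonormal_basis hs z (fun a => E a z).
Hypothesis hu : hs x \in unitmx.
Hypothesis hsym : \forall z \near x, (hs z)^T = hs z.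
Hypothesis dh : mxdifferentiable hs x.
Hypothesis dE : forall a, mxdifferentiable (E a) x.
Hypothesis dF : forall k, twice_differentiable (fun z => F z 0 k) x.
Hypothesis dPsi : cmxdifferentiable Psi x.
Hypothesis gu : \forall z \near F x, g b z \in unitmx.
Hypothesis gs : \forall z \near F x, (g b z)^T = g b z.
Hypothesis dg : forall i j, twice_differentiable (fun z => g b z i j) (F x).
Hypothesis dX : forall k, twice_differentiable (fun z => X b z 0 k) (F x).
Hypothesis killX : \forall z \near F x, forall i j,
  nabla_lower (g b) (X b) i j z + nabla_lower (g b) (X b) j i z = 0.

Let dF1 k : differentiable (fun z => F z 0 k) x := twice_differentiableW (dF k).

Let onx : orthonormal_basis hs x (fun a => E a x) := nbhs_singleton on.

Lemma spin_connection_skew a c d :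
  spin_connection x a c d = - spin_connection x a d c.
Proof.
apply: (inner_nabla_skew hu hsym dh (c := (c == d)%:R)) => //.
by apply: filterS on => z; apply.
Qed.

Let dphi_expand : \forall z \near x, forall Y k,
  dphi phi s b Y z 0 k = \sum_l Y 0 l * dphi phi s b (delta_mx 0 l) z 0 k.
Proof.
have nF : \forall z \near x, forall k, differentiable (fun z => F z 0 k) z.
  exact: (@filter_forall _ _ (fun k z => differentiable (fun z => F z 0 k) z) _
    (nbhs_filter x) (fun k => (dF k).1)).
apply: filterS nF => z dz Y k; rewrite mxE derive_row_expand //.
by apply: eq_bigr => l _; rewrite mxE.
Qed.

Let ddphi l k : differentiable (fun z => dphi phi s b (delta_mx 0 l) z 0 k) x.
Proof. by under eq_fun do rewrite mxE; have [_] := dF k. Qed.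

(** The direction of differentiation moves with z; expanding it in coordinate directions separates
    the frame from the derivatives of the map. *)
Lemma mxdifferentiable_dphi_frame a :
  mxdifferentiable (fun z => dphi phi s b (E a z) z) x.
Proof.
move=> i k; rewrite ord1.
apply: (@near_eq_differentiable _ _ _
  (fun z => \sum_l E a z 0 l * dphi phi s b (delta_mx 0 l) z 0 k)).
  by apply: filterS dphi_expand => z ->.
by apply: differentiable_bigsum => l; apply: differentiableM => //; exact: dE.
Qed.

Let dAA : mxdifferentiable AA x.
Proof. exact: mxdifferentiable_nabla_lower_mx. Qed.

Lemma cmxdifferentiable_spinor_bilinear c : cmxdifferentiable (spinor_bilinear c) x.
Proof.
apply: cmxdifferentiableM => //; apply: cmxdifferentiableM.
  exact: cmxdifferentiable_adj.
exact: cmxdifferentiable_cst.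
Qed.

Lemma cmxderive_spinor_bilinear c v : cmxderive v (spinor_bilinear c) x =
  adjmx (cmxderive v Psi x) *m G c *m Psi x
  + adjmx (Psi x) *m G c *m cmxderive v Psi x.
Proof.
have dadj := cmxdifferentiable_adj dPsi.
have dG := cmxdifferentiable_cst (G c) x.
rewrite cmxderiveM //; last exact: cmxdifferentiableM.
by rewrite cmxderiveM // cmxderive_adj // cmxderive_cst mulmx0 addr0.
Qed.

Let dAAt : cmxdifferentiable (fun z => (realmx (AA z))^T) x.
Proof. by apply: cmxdifferentiable_tr; exact: cmxdifferentiable_real. Qed.

Let dBA c : cmxdifferentiable (fun z => spinor_bilinear c z *m (realmx (AA z))^T) x.
Proof.
by apply: cmxdifferentiableM => //; exact: cmxdifferentiable_spinor_bilinear.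
Qed.

Lemma cdifferentiable_spinor_current c : cdifferentiable (spinor_current c) x.
Proof. exact (cdifferentiable_sum _ (fun i => dBA c i i)). Qed.

Lemma cderive_spinor_current c v : cderive v (spinor_current c) x =
  \tr (adjmx (cmxderive v Psi x) *m G c *m Psi x *m (realmx (AA x))^T)
  + \tr (adjmx (Psi x) *m G c *m cmxderive v Psi x *m (realmx (AA x))^T)
  + \tr (adjmx (Psi x) *m G c *m Psi x *m (realmx (mxderive v AA x))^T).
Proof.
rewrite cderive_trace // cmxderiveM //; last exact: cmxdifferentiable_spinor_bilinear.
by rewrite cmxderive_spinor_bilinear mulmxDl !mxtraceD cmxderive_tr cmxderive_real.
Qed.

Lemma cdifferentiable_current l :
  cdifferentiable (fun z => current g s b psi X z (delta_mx 0 l)) x.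
Proof.
under eq_fun do rewrite currentE.
apply: cdifferentiableD.
  apply: cdifferentiable_real; apply: differentiableM; first exact: differentiable_cst.
  apply: differentiable_bigsum => k; apply: differentiableM => //.
  exact: differentiable_lower_comp.
apply: cdifferentiableN; apply: cdifferentiable_sum => c; apply: cdifferentiableM.
  apply: cdifferentiable_real.
  apply: (@mxdifferentiableM _ _ _ _ _ (fun z => delta_mx 0 l *m hs z)
    (fun z => (E c z)^T)); last exact: mxdifferentiable_tr.
  by apply: mxdifferentiableM => // i j; exact: differentiable_cst.
exact: cdifferentiable_spinor_current.
Qed.

Lemma current_expand : \forall z \near x, forall Y,
  current g s b psi X z Y =
  \sum_l (Y 0 l)%:C * current g s b psi X z (delta_mx 0 l).
Proof.
apply: filterS dphi_expand => z dz Y.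
under [RHS]eq_bigr => l _ do rewrite currentE mulrBr -rmorphM.
rewrite currentE sumrB -rmorph_sum; congr (_%:C - _).
  under [RHS]eq_bigr => l _ do rewrite !mulr_sumr.
  rewrite mulr_sumr [RHS]exchange_big; apply: eq_bigr => k _.
  by rewrite dz !mulr_sumr; apply: eq_bigr => l _; ring.
under [RHS]eq_bigr => l _ do rewrite mulr_sumr.
rewrite [RHS]exchange_big; apply: eq_bigr => c _.
rewrite inner_expand rmorph_sum mulr_suml; apply: eq_bigr => l _.
by rewrite rmorphM mulrA.
Qed.

Lemma divergence_current :
  divergence hs (fun a => E a x) (current g s b psi X) x =
  \sum_a ((2 * ('D_(E a x) (fun z => \sum_k L k (F z) * dphi phi s b (E a z) z 0 k) x
          - \sum_k L k (F x) * dphi phi s b (nabla hs (E a x) (E a) x) x 0 k))%:C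
    - (cderive (E a x) (spinor_current a) x
       - \sum_c (spin_connection x a a c)%:C * spinor_current c x)).
Proof.
apply: eq_bigr => a _.
rewrite (nabla_form_diag hs current_expand cdifferentiable_current); last first.
  by move=> l; exact: dE.
rewrite (@near_eq_cderive _ _ _ (fun z =>
  (2 * \sum_k L k (F z) * dphi phi s b (E a z) z 0 k)%:C + - spinor_current a z));
  last by apply: filterS on => z; exact: current_frame.
have dS : differentiable (fun z => \sum_k L k (F z) * dphi phi s b (E a z) z 0 k) x.
  apply: differentiable_bigsum => k; apply: differentiableM.
    exact: differentiable_lower_comp.
  exact: mxdifferentiable_dphi_frame.
have d2S : differentiable (fun z => 2 * \sum_k L k (F z) * dphi phi s b (E a z) z 0 k) x.
  by apply: differentiableM => //; exact: differentiable_cst.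
rewrite cderiveD; [|exact: cdifferentiable_real|
  apply: cdifferentiableN; exact: cdifferentiable_spinor_current].
rewrite cderiveN; last exact: cdifferentiable_spinor_current.
(* [currentE] splits nabla_{e_a} e_a along the frame, with components [spin_connection x a a]. *)
rewrite cderive_real derive_scale // currentE -/(spin_connection x a a).
rewrite mulrBr rmorphB !opprD !opprK /=.
move: (_%:C) (_%:C) (cderive _ _ _) => p q r; ring.
Qed.

Lemma dphi_divergence :
  \sum_a ('D_(E a x) (fun z => \sum_k L k (F z) * dphi phi s b (E a z) z 0 k) x
    - \sum_k L k (F x) * dphi phi s b (nabla hs (E a x) (E a) x) x 0 k) =
  \sum_k L k (F x) * tension g phi s b x 0 k.
Proof.
under [RHS]eq_bigr => k _ do rewrite /tension summxE mulr_sumr.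
rewrite [RHS]exchange_big; apply: eq_bigr => a _.
have -> := derive_lower_pairing dg dX killX dF1 (mxdifferentiable_dphi_frame a) (erefl _).
rewrite -sumrB; apply: eq_bigr => k _; rewrite -mulrBr; congr (_ * _).
by rewrite [RHS]mxE [in RHS]mxE [in RHS]mxE.
Qed.

Lemma spinor_divergence :
  dirac g phi s b Psi x = 0 ->
  \sum_a (cderive (E a x) (spinor_current a) x
       - \sum_c (spin_connection x a a c)%:C * spinor_current c x) =
  \sum_a \sum_i \sum_j spinor_bilinear a x i j *
    (\sum_l L l (F x) * curvature_op (g b) i j (F x) (dphi phi s b (E a x) x) 0 l)%:C.
Proof.
move=> dir.
under eq_bigr => a _ do rewrite cderive_spinor_current.
pose K a := connection_mx (g b) (F x) (dphi phi s b (E a x) x).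
have dPE a : cmxderive (E a x) Psi x =
    nabla_twisted g phi s b (E a x) Psi x
    - spin_mx G (spin_connection x a) *m Psi x - Psi x *m realmx (K a).
  by rewrite nabla_twistedE -/(K a) addrAC addrK addrK.
have dirac0 : \sum_a G a *m nabla_twisted g phi s b (E a x) Psi x = 0.
  by rewrite -[RHS]dir; apply: eq_bigr => a _; rewrite clifford_mul_frame.
rewrite (dirac_current_divergence (AA x)
  (fun a => mxderive (E a x) AA x) spin_connection_skew dPE dirac0).
apply: eq_bigr => a _; rewrite mxtrace_realmx_tr.
apply: eq_bigr => i _; apply: eq_bigr => j _; congr (_ * _%:C).
exact: (nabla_lower_mx_covariant gu gs dg dX killX dF1).
Qed.

Lemma divergence_current_eq0 :
  (forall k, (tension g phi s b x 0 k)%:C = spinor_curvature g s b psi x k) ->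
  dirac g phi s b Psi x = 0 ->
  divergence hs (fun a => E a x) (current g s b psi X) x = 0.
Proof.
move=> tens dir; rewrite divergence_current sumrB spinor_divergence //.
rewrite -rmorph_sum -mulr_sumr dphi_divergence; apply/eqP; rewrite subr_eq0; apply/eqP.
rewrite rmorphM rmorph_sum /=.
under eq_bigr => k _ do rewrite rmorphM /= tens /spinor_curvature.
rewrite (rmorph_nat (real_complex R) 2) mulr_sumr.
transitivity (\sum_k \sum_a \sum_i \sum_j (L k (F x))%:C * (spinor_bilinear a x i j *
   (curvature_op (g b) i j (F x) (dphi phi s b (E a x) x) 0 k)%:C)).
  (* The 2 in the first half of the current meets the 2^-1 in the equation for the tension field. *)
  apply: eq_bigr => k _; rewrite mulrCA [2 * (2^-1 * _)]mulrA divff ?mul1r ?pnatr_eq0 //.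
  rewrite mulr_sumr; apply: eq_bigr => a _; rewrite mulr_sumr.
  apply: eq_bigr => i _; rewrite mulr_sumr; apply: eq_bigr => j _.
  by rewrite spinor_pairing_frame.
rewrite exchange_big; apply: eq_bigr => a _; rewrite exchange_big; apply: eq_bigr => i _.
rewrite exchange_big; apply: eq_bigr => j _; rewrite rmorph_sum mulr_sumr.
by apply: eq_bigr => k _; rewrite rmorphM mulrCA.
Qed.

End Current.

Theorem theorem4p4 (R : realType) (m n : nat)
  (M : manifold R m) (h : metric M) (G : spinor_module R m)
  (S : spin_structure h G) (closedM : closed_manifold M)
  (N : manifold R n) (g : metric N)
  (X : vector_field N) (killingX : killing g X)
  (phi : M -> N) (psi : vector_spinor S phi)
  (harm : dirac_harmonic g psi) :
  forall (s : triv S) (b : chart N) (x : 'rV[R]_m), local_dom phi s b x ->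
  forall e : 'I_m -> 'rV[R]_m, orthonormal_basis (h (triv_chart s)) x e ->
    divergence (h (triv_chart s)) e (current g s b psi X) x = 0%R.
Proof.
move=> s b x Dx e one.
have [[cphi sphi] eqs] := harm; have [tens dir] := eqs s b x Dx.
have oD : open (local_dom phi s b) by exact: local_dom_open.
have nD : \forall z \near x, local_dom phi s b z by exact: open_nbhs_nbhs.
have on : \forall z \near x, orthonormal_basis (h (triv_chart s)) z (fun a => e_ s a z).
  by apply: filterS nD => _ [p [sp _] <-]; exact: frame_orthonormal.
have Dh : (coord (triv_chart s) @` dom (triv_chart s)) x.
  by have [p [sp _] <-] := Dx; exists p => //; exact: triv_sub.
have Dg : (coord b @` dom b) (local_map phi s b x).
  have [p [sp bp] <-] := Dx; exists (phi p) => //.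
  by rewrite /local_map coordK //; exact: triv_sub.
(* The given [e] lives at the point [x] alone; the frame is a field that can be differentiated. *)
rewrite (divergence_basis _ one (nbhs_singleton on)).
apply: divergence_current_eq0 => //.
- exact: nbhs_singleton (gram_near_unit h Dh).
- exact: gram_near_sym.
- by move=> i j; apply: twice_differentiableW; exact: gram_twice_differentiable.
- move=> a i j; under eq_fun do rewrite mxE.
  apply: twice_differentiableW.
  apply: (smooth_on_twice_differentiable oD Dx).
  apply: smooth_on_sub (@frame_smooth _ _ _ _ _ S s a j) => _ [p [sp _] <-].
  by exists p.
- move=> k; apply: (smooth_on_twice_differentiable oD Dx).
  apply: smooth_on_sub (sphi (triv_chart s) b k) => _ [p [sp bp] <-].
  by exists p => //; split=> //; exact: triv_sub.
- move=> q i; have [sr si] := @vs_smooth _ _ _ _ _ _ _ _ _ psi s b q i.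
  by split; apply: twice_differentiableW;
    apply: (smooth_on_twice_differentiable oD Dx).
- exact: gram_near_unit.
- exact: gram_near_sym.
- by move=> i j; exact: gram_twice_differentiable.
- by move=> k; exact: vector_field_twice_differentiable.
- exact: killing_near.
Qed.
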